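(* Let $X$ be a compact Hausdorff space, $\mathcal A=C(X)$, and let $K:l_2(\mathcal A)\to l_2(\mathcal A)$ be a bounded $\mathcal A$-operator. Then $K$ is a compact $\mathcal A$-operator, i.e. $K\in\mathcal K(l_2(\mathcal A))$, if and only if $\mathcal D(K)(x)$ is a compact operator on $H$ for every $x\in X$ and the map $\mathcal D(K):X\to\mathcal K(H)$ is continuous with respect to the $IM$-topology on $\mathcal K(H)$.
   Context: $H$ is the standard separable infinite-dimensional complex Hilbert space with orthonormal basis $e_1,e_2,\dots$; $\mathcal B(H)$, $\mathcal K(H)$, $GL(H)$ denote respectively the bounded, compact, and invertible bounded operators on $H$. For $\mathcal A=C(X)$ (continuous complex functions on $X$), $l_2(\mathcal A)$ is the Hilbert (left) $\mathcal A$-module of sequences $(\xi_1,\xi_2,\dots)$, $\xi_k\in\mathcal A$, with $\sum_k\xi_k\xi_k^*$ convergent in norm in $\mathcal A$, with norm $\|\sum_k\xi_k\xi_k^*\|^{1/2}$. It is identified with the set $[X,H]$ of norm-continuous maps $\varphi:X\to H$ via $\varphi(x)=\sum_k\xi_k(x)e_k$. An $\mathcal A$-operator is an $\mathcal A$-linear map; no adjoint is assumed to exist. For a bounded $\mathcal A$-operator $B$ on $l_2(\mathcal A)$, $\mathcal D(B):X\to\mathcal B(H)$ is defined by $\mathcal D(B)(x)(a)=(B\varphi_a)(x)$, where $a\in H$ and $\varphi_a\in[X,H]$ is the constant map $\varphi_a\equiv a$. A bounded $\mathcal A$-operator on $l_2(\mathcal A)$ is finitely generated if it is a composition $l_2(\mathcal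 A)\to M\to l_2(\mathcal A)$ of bounded $\mathcal A$-operators with $M$ a Hilbert $\mathcal A$-module that is algebraically finitely generated. $\mathcal K(l_2(\mathcal A))$ (the compact $\mathcal A$-operators) is the operator-norm closure of the set of finitely generated $\mathcal A$-operators. The $IM$-topology on $\mathcal K(H)$: for $n\ge 0$ let $L_n=\mathrm{span}(e_1,\dots,e_n)$ and let $Q_n$ be the orthogonal projection of $H$ onto $L_n^\perp$ (so $Q_0=\mathrm{id}$). For $\varepsilon>0$, $a_1,\dots,a_n\in H$, $S\in GL(H)$ and $K\in\mathcal K(H)$ put $$U_{\varepsilon,a_1,\dots,a_n,K}=\{B\in\mathcal K(H):\|(B-K)a_i\|<\varepsilon\ \ \forall i=1,\dots,n\},$$ $$U_{\varepsilon,n,S,K}=\{B\in\mathcal K(H):\exists R\in GL(H)\text{ such that }\|R(S+Q_nB)-(S+Q_nK)\|<\varepsilon\},$$ $$U_{\varepsilon,S,K}=\bigcap_{n=0}^\infty U_{\varepsilon,n,S,K}.$$ The $IM$-topology is the topology with subbase consisting of all sets $U_{\varepsilon,a_1,\dots,a_n,K}$ and $U_{\varepsilon,S,K}$. *)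

(* Defs.v *)
From HB Require Import structures.
From mathcomp Require Import all_boot all_order all_algebra.
From mathcomp Require Import sesquilinear complex.
From mathcomp Require Import all_classical all_reals all_analysis.

From mathcomp Require Import ring lra.

Set Implicit Arguments.
Unset Strict Implicit.
Unset Printing Implicit Defensive.

Import Order.TTheory GRing.Theory Num.Theory.
Import numFieldNormedType.Exports.

Local Open Scope classical_set_scope.
Local Open Scope complex_scope.
Local Open Scope ring_scope.

(* Norms of normed modules over R[i] live in R[i]; normR is the same norm as
   an element of R. *)
Definition normR (R : realType) (V : normedZmodType R[i]) (v : V) : R :=
  complex.Re `|v|.

Section normR_theory.
Variables (R : realType) (V : normedZmodType R[i]).
Implicit Types u v : V.

Lemma normRE v : `|v| = (normR v)%:C.
Proof. by rewrite /normR RRe_real. Qed.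

Lemma normR_ge0 v : 0 <= normR v.
Proof. by rewrite -lecR -normRE normr_ge0. Qed.

Lemma normR0 : normR (0 : V) = 0.
Proof. by rewrite /normR normr0. Qed.

Lemma normR0_eq0 v : normR v = 0 -> v = 0.
Proof. by move=> v0; apply/eqP; rewrite -normr_eq0 normRE v0. Qed.

Lemma ler_normRD u v : normR (u + v) <= normR u + normR v.
Proof. by rewrite -lecR rmorphD/= -!normRE ler_normD. Qed.

Lemma normRN v : normR (- v) = normR v.
Proof. by rewrite /normR normrN. Qed.

Lemma normR_distC u v : normR (u - v) = normR (v - u).
Proof. by rewrite -opprB normRN. Qed.

End normR_theory.

Lemma normRM (R : realType) (a b : R[i]) : normR (a * b) = normR a * normR b.
Proof. by apply: complexI; rewrite rmorphM/= -!normRE normrM. Qed.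

HB.mixin Record isCompactHausdorff X of Topological X := {
  compactX : compact [set: X];
  hausdorffX : hausdorff_space X
}.

#[short(type="compactHausdorffType")]
HB.structure Definition CompactHausdorff :=
  {X of Topological X & isCompactHausdorff X}.

Section CX.
Variables (R : realType) (X : compactHausdorffType).

(* C(X); the codomain is R[i]^o because only the regular module R[i]^o carries
   the topology of R[i]. *)
Definition CX := continuousType X R[i]^o.

HB.instance Definition _ := Choice.on CX.

Definition CX_fun (f : CX) : X -> R[i] := f.
Coercion CX_fun : CX >-> Funclass.

Lemma CX_cts (f : CX) : continuous (f : X -> R[i]^o).
Proof. exact: cts_fun. Qed.

Definition mkCX (f : X -> R[i]^o) (fc : continuous f) : CX :=
  (mkcts fc : continuousType X R[i]^o).

Lemma CXP (f g : CX) : (forall x, f x = g x) -> f = g.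
Proof. by move=> fg; apply/continuousEP. Qed.


Lemma normR_cvgP (T : Type) (F : set_system T) {FF : Filter F}
    (V : normedModType R[i]) (f : T -> V) (y : V) :
  f @ F --> y <-> forall eps : R, 0 < eps -> \forall t \near F, normR (y - f t) < eps.
Proof.
split=> [/cvgrPdist_lt fy eps e0|fy].
  have := fy eps%:C; rewrite ltcR => /(_ e0); apply: filterS => t.
  by rewrite normRE ltcR.
apply/cvgrPdist_lt => eps e0.
have er : (complex.Re eps)%:C = eps by rewrite RRe_real// gtr0_real.
have : 0 < complex.Re eps by rewrite -ltcR er.
by move=> /fy; apply: filterS => t; rewrite -er normRE ltcR.
Qed.

Lemma CX_addP (f g : CX) : continuous (fun x => f x + g x : R[i]^o).
Proof. by move=> x; apply: (@cvgD _ R[i]^o); exact: CX_cts. Qed.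

Lemma CX_oppP (f : CX) : continuous (fun x => - f x : R[i]^o).
Proof. by move=> x; apply: (@cvgN _ R[i]^o); exact: CX_cts. Qed.

Lemma CX_mulP (f g : CX) : continuous (fun x => f x * g x : R[i]^o).
Proof. by move=> x; apply: (@cvgM R[i]); exact: CX_cts. Qed.

Lemma CX_starP (f : CX) : continuous (fun x => Num.conj (f x) : R[i]^o).
Proof.
move=> x; apply/normR_cvgP => eps e0.
have /normR_cvgP/(_ _ e0) := @CX_cts f x; apply: filterS => y.
by rewrite -rmorphB /normR norm_conjC.
Qed.

Definition CX_cst (c : R[i]) : CX := mkCX (@cst_continuous X R[i]^o c).
Definition CX_add (f g : CX) : CX := mkCX (@CX_addP f g).
Definition CX_opp (f : CX) : CX := mkCX (@CX_oppP f).
Definition CX_mul (f g : CX) : CX := mkCX (@CX_mulP f g).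
Definition CX_star (f : CX) : CX := mkCX (@CX_starP f).

Lemma CX_addA : associative CX_add.
Proof. by move=> f g h; apply: CXP => x; exact: addrA. Qed.
Lemma CX_addC : commutative CX_add.
Proof. by move=> f g; apply: CXP => x; exact: addrC. Qed.
Lemma CX_add0 : left_id (CX_cst 0) CX_add.
Proof. by move=> f; apply: CXP => x; exact: add0r. Qed.
Lemma CX_addN : left_inverse (CX_cst 0) CX_opp CX_add.
Proof. by move=> f; apply: CXP => x; exact: addNr. Qed.

HB.instance Definition _ :=
  GRing.isZmodule.Build CX CX_addA CX_addC CX_add0 CX_addN.

Lemma CX_mulA : associative CX_mul.
Proof. by move=> f g h; apply: CXP => x; exact: mulrA. Qed.
Lemma CX_mulC : commutative CX_mul.
Proof. by move=> f g; apply: CXP => x; exact: mulrC. Qed.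
Lemma CX_mul1 : left_id (CX_cst 1) CX_mul.
Proof. by move=> f; apply: CXP => x; exact: mul1r. Qed.
Lemma CX_mulDl : left_distributive CX_mul CX_add.
Proof. by move=> f g h; apply: CXP => x; exact: mulrDl. Qed.

HB.instance Definition _ :=
  GRing.Zmodule_isComPzRing.Build CX CX_mulA CX_mulC CX_mul1 CX_mulDl.

Definition CX_scale (c : R[i]) (f : CX) : CX := CX_cst c * f.

Lemma CX_scaleA a b f : CX_scale a (CX_scale b f) = CX_scale (a * b) f.
Proof. by apply: CXP => x; exact: mulrA. Qed.
Lemma CX_scale1 : left_id 1 CX_scale.
Proof. by move=> f; apply: CXP => x; exact: mul1r. Qed.
Lemma CX_scaleDr : right_distributive CX_scale +%R.
Proof. by move=> c f g; apply: CXP => x; exact: mulrDr. Qed.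
Lemma CX_scaleDl f : {morph CX_scale^~ f : a b / a + b}.
Proof. by move=> a b; apply: CXP => x; exact: mulrDl. Qed.

HB.instance Definition _ := GRing.Zmodule_isLmodule.Build R[i] CX
  CX_scaleA CX_scale1 CX_scaleDr CX_scaleDl.

(* sup set0 = 0, so the norm is 0 when X is empty *)
Definition CX_supnorm (f : CX) : R :=
  sup [set normR (f x : R[i]^o) | x in [set: X]].

Lemma CX_bounded (f : CX) : has_ubound [set normR (f x : R[i]^o) | x in [set: X]].
Proof.
have normRc : continuous (fun x => normR (f x : R[i]^o) : R).
  move=> x; apply/cvgrPdist_lt => eps e0.
  have /normR_cvgP/(_ _ e0) := @CX_cts f x; apply: filterS => y.
  apply: le_lt_trans; rewrite ler_norml lerBlDr lerNl opprB lerBlDr.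
  apply/andP; split.
    by rewrite -{1}(subrK (f x) (f y)) normR_distC (le_trans (ler_normRD _ _)).
  by rewrite -{1}(subrK (f y) (f x)) (le_trans (ler_normRD _ _)).
have : compact [set normR (f x : R[i]^o) | x in [set: X]].
  apply: continuous_compact; last exact: compactX.
  exact/continuous_subspaceT.
move=> /compact_bounded [M [_ /(_ (M + 1))]]; rewrite ltrDl => /(_ ltr01) fM.
by exists (M + 1) => r /fM; exact/le_trans/ler_norm.
Qed.

Lemma CX_le_supnorm (f : CX) x : normR (f x) <= CX_supnorm f.
Proof. by apply: ub_le_sup; [exact: CX_bounded|exists x]. Qed.

Lemma CX_supnorm_le (f : CX) (c : R) :
  0 <= c -> (forall x, normR (f x) <= c) -> CX_supnorm f <= c.
Proof.
move=> c0 fc; rewrite /CX_supnorm.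
have [->|X0] := eqVneq [set normR (f x : R[i]^o) | x in [set: X]] set0.
  by rewrite sup0.
by apply: ge_sup; [exact/set0P|move=> _ [x _ <-]].
Qed.

Lemma CX_supnorm_ge0 (f : CX) : 0 <= CX_supnorm f.
Proof.
have [X0|/set0P[_ [x _ _]]] :=
    eqVneq [set normR (f x : R[i]^o) | x in [set: X]] set0.
  by rewrite /CX_supnorm X0 sup0.
exact: le_trans (normR_ge0 _) (CX_le_supnorm f x).
Qed.

Definition CX_norm (f : CX) : R[i] := (CX_supnorm f)%:C.

Lemma CX_normD f g : CX_norm (f + g) <= CX_norm f + CX_norm g.
Proof.
rewrite -rmorphD/= lecR; apply: CX_supnorm_le => [|x].
  by rewrite addr_ge0// CX_supnorm_ge0.
by apply: le_trans (ler_normRD _ _) _; rewrite lerD// CX_le_supnorm.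
Qed.

Lemma CX_normZ (l : R[i]) (f : CX) : CX_norm (l *: f) = `|l| * CX_norm f.
Proof.
rewrite normRE -rmorphM/=; congr (_%:C); apply/eqP; rewrite eq_le.
apply/andP; split.
  apply: CX_supnorm_le => [|x]; first by rewrite mulr_ge0 ?normR_ge0 ?CX_supnorm_ge0.
  by rewrite (normRM l (f x)) ler_wpM2l ?normR_ge0 ?CX_le_supnorm.
have [->|l0] := eqVneq l 0; first by rewrite normR0 mul0r CX_supnorm_ge0.
have nl0 : 0 < normR l by rewrite -ltcR -normRE normr_gt0.
rewrite -ler_pdivlMl//; apply: CX_supnorm_le => [|x].
  by rewrite mulr_ge0 ?invr_ge0 ?CX_supnorm_ge0 ?ltW.
rewrite ler_pdivlMl// -normRM; exact: (CX_le_supnorm (l *: f) x).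
Qed.

Lemma CX_norm0_eq0 f : CX_norm f = 0 -> f = 0.
Proof.
move=> /complexI f0; apply: CXP => x; apply: normR0_eq0; apply/eqP.
by rewrite eq_le normR_ge0 -f0 CX_le_supnorm.
Qed.

HB.instance Definition _ := Lmodule_isNormed.Build R[i] CX
  CX_normD CX_normZ CX_norm0_eq0.


Lemma CX_normRE (f : CX) : normR f = CX_supnorm f.
Proof. by []. Qed.

Lemma CX_complete (F : set_system CX) : ProperFilter F -> cauchy F -> cvg F.
Proof.
move=> FF /cauchyP Fc.
have {}Fc (eps : R) : 0 < eps ->
    exists g : CX, F [set f : CX | forall x, normR (g x - f x) <= eps].
  move=> e0; have [|g Fg] := Fc eps%:C; first by rewrite ltcR.
  exists g; move: Fg; apply: filterS => f; rewrite -ball_normE/= => gf x.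
  apply: le_trans (CX_le_supnorm (g - f) x) _.
  by rewrite -CX_normRE ltW// -ltcR -normRE.
have ReIm (u : R[i] -> R) : (forall a, `|u a| <= normR a) ->
    {morph u : a b / a - b} -> forall x, cvg ((fun f : CX => u (f x)) @ F).
  move=> un uB x; apply: (@R_complete R); apply/cauchyP => eps e0.
  have [|g Fg] := Fc (eps / 2); first by rewrite divr_gt0.
  exists (u (g x)); rewrite /nbhs/=; move: Fg; apply: filterS => f /(_ x) gf.
  rewrite -ball_normE/= -uB (le_lt_trans (un _))// (le_lt_trans gf)//.
  by rewrite gtr_pMr// invf_lt1// ltr1n.
have Ren (a : R[i]) : `|complex.Re a| <= normR a.
  by rewrite -lecR -normRE normc_ge_Re.
have Imn (a : R[i]) : `|complex.Im a| <= normR a.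
  rewrite /normR normc_def/= -sqrtr_sqr ler_sqrt ?addr_ge0 ?sqr_ge0//.
  by rewrite lerDr sqr_ge0.
have cRe := ReIm _ Ren (raddfB _).
have cIm := ReIm _ Imn (raddfB _).
pose h x : R[i]^o := lim ((fun f : CX => complex.Re (f x)) @ F) +i*
                     lim ((fun f : CX => complex.Im (f x)) @ F).
have hF (eps : R) : 0 < eps -> F [set f : CX | forall x, normR (V := R[i]) (h x - f x) <= eps].
  move=> e0; have e3 : 0 < eps / 3 by rewrite divr_gt0.
  have [g Fg] := Fc _ e3.
  have gh x : normR (h x - g x) <= eps / 3 + eps / 3.
    have lim_le (u : R[i] -> R) : (forall a, `|u a| <= normR a) ->
        {morph u : a b / a - b} -> cvg ((fun f : CX => u (f x)) @ F) ->
        `|lim ((fun f : CX => u (f x)) @ F) - u (g x)| <= eps / 3.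
      move=> un uB uc; rewrite ler_distl; apply/andP; split.
        apply: limr_ge => //; move: Fg; apply: filterS => f /(_ x).
        move=> /(le_trans (un _)); rewrite uB ler_distl.
        by move=> /andP[_]; rewrite lerBlDr.
      apply: limr_le => //; move: Fg; apply: filterS => f /(_ x).
      by move=> /(le_trans (un _)); rewrite uB ler_distlC => /andP[].
    have hgE : h x - g x =
       (complex.Re (h x) - complex.Re (g x))%:C +
       (complex.Im (h x) - complex.Im (g x))%:C * 'i%C.
      by case: (g x) => a b; simpc.
    rewrite [leLHS](_ : _ = normR (V := R[i]) (h x - g x))// hgE.
    rewrite (le_trans (ler_normRD _ _))// normRM.
    have nr (r : R) : normR (r%:C) = `|r| by rewrite /normR normc_def/= expr0n/= addr0 sqrtr_sqr.
    rewrite !nr [normR 'i%C](_ : _ = 1) ?mulr1; last first.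
      by rewrite /normR normc_def/= expr0n/= add0r expr1n sqrtr1.
    by rewrite lerD// lim_le//; exact: raddfB.
  move: Fg; apply: filterS => f /(_ _) gf x.
  rewrite -(subrK (g x) (h x)) -addrA (le_trans (ler_normRD _ _))//.
  rewrite [leRHS](_ : _ = eps / 3 + eps / 3 + eps / 3) ?lerD ?gh ?gf//.
  by field.
have hc : continuous h.
  move=> x; apply/normR_cvgP => eps e0.
  have e3 : 0 < eps / 3 by rewrite divr_gt0.
  have [f hf] := filter_ex (hF _ e3).
  have /normR_cvgP/(_ _ e3) := @CX_cts f x; apply: filterS => y fxy.
  have -> : h x - h y = (h x - f x) + ((f x - f y) + - (h y - f y)).
    by rewrite opprB !addrA !subrK.
  apply: le_lt_trans (ler_normRD _ _) _.
  apply: le_lt_trans (_ : _ <= eps / 3 + (normR (V := R[i]) (f x - f y) + eps / 3)) _.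
    rewrite lerD ?hf// (le_trans (ler_normRD _ _))// lerD// normRN; exact: hf.
  rewrite [ltRHS](_ : eps = eps / 3 + (eps / 3 + eps / 3)).
    by rewrite ltrD2l ltrD2r.
  by field.
apply/cvg_ex; exists (mkCX hc); apply/normR_cvgP => eps e0.
have /hF : 0 < eps / 2 by rewrite divr_gt0.
apply: filterS => f hf; rewrite CX_normRE.
apply: (@le_lt_trans _ _ (eps / 2)); last first.
  by rewrite gtr_pMr// invf_lt1// ltr1n.
by apply: CX_supnorm_le => // ; rewrite divr_ge0// ltW.
Qed.

HB.instance Definition _ := Uniform_isComplete.Build CX CX_complete.

End CX.

Section l2.
Variables (R : realType) (X : compactHausdorffType).
Local Notation A := (CX R X).

Definition l2_summable (xi : nat -> A) : Prop :=
  cvgn (series (fun k => xi k * CX_star (xi k))).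

Record l2 := MkL2 { l2_seq :> nat -> A; l2P : l2_summable l2_seq }.

HB.instance Definition _ := gen_eqMixin l2.
HB.instance Definition _ := gen_choiceMixin l2.

Lemma l2_eqP (xi eta : l2) : (forall k, xi k = eta k) -> xi = eta.
Proof.
case: xi eta => [xi xiP] [eta etaP] /= /funext xe; rewrite xe in xiP *.
by congr MkL2; exact: Prop_irrelevance.
Qed.

Lemma CX_sumE (I : Type) (s : seq I) (P : pred I) (f : I -> A) x :
  (\sum_(i <- s | P i) f i) x = \sum_(i <- s | P i) f i x.
Proof. exact: (big_morph (fun g : A => g x) (fun g h => erefl) erefl). Qed.

Lemma CX_star_sumE (xi : nat -> A) m n x :
  normR ((\sum_(m <= k < n) xi k * CX_star (xi k)) x) =
  \sum_(m <= k < n) normR (xi k x) ^+ 2.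
Proof.
apply: complexI; rewrite -normRE CX_sumE rmorph_sum/= ger0_norm.
  by apply: eq_bigr => k _; rewrite rmorphXn/= -normRE normCK.
by apply: sumr_ge0 => k _; rewrite mul_conjC_ge0.
Qed.

Lemma l2_summableP (xi : nat -> A) : l2_summable xi <->
  forall eps : R, 0 < eps -> \forall n \near (\oo, \oo),
    forall x, \sum_(n.1 <= k < n.2) normR (xi k x) ^+ 2 <= eps.
Proof.
split.
  move=> /cauchy_cvgP/cauchy_seriesP + eps e0 => /(_ eps%:C).
  rewrite ltcR => /(_ e0); apply: filterS => n.
  rewrite normRE ltcR CX_normRE => nx x; rewrite -CX_star_sumE.
  exact/(le_trans _ (ltW nx))/CX_le_supnorm.
move=> xiP; apply/cauchy_cvgP/cauchy_seriesP => eps e0.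
have er : (complex.Re eps)%:C = eps by rewrite RRe_real// gtr0_real.
have {}e0 : 0 < complex.Re eps by rewrite -ltcR er.
have e2 : 0 < complex.Re eps / 2 by rewrite divr_gt0.
apply: filterS (xiP _ e2) => n nx; rewrite -er normRE ltcR CX_normRE.
apply: (@le_lt_trans _ _ (complex.Re eps / 2)).
  by apply: CX_supnorm_le => [|x]; [exact: ltW|rewrite CX_star_sumE].
by rewrite gtr_pMr// invf_lt1// ltr1n.
Qed.

Lemma l2_dominated (xi eta zeta : nat -> A) (c : R) : 0 < c ->
  l2_summable xi -> l2_summable eta ->
  (forall k x, normR (zeta k x) ^+ 2 <=
     c * (normR (xi k x) ^+ 2 + normR (eta k x) ^+ 2)) ->
  l2_summable zeta.
Proof.
move=> c0 /l2_summableP xiP /l2_summableP etaP zx; apply/l2_summableP => eps e0.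
have e1 : 0 < eps / c / 2 by rewrite !divr_gt0.
apply: filterS2 (xiP _ e1) (etaP _ e1) => n nx ne x.
apply: le_trans (ler_sum _ (fun k _ => zx k x)) _.
rewrite -mulr_sumr big_split/= -ler_pdivlMl//.
apply: le_trans (lerD (nx x) (ne x)) _.
by rewrite -mulr2n -[_ *+ 2]mulr_natr divfK// mulrC.
Qed.

Lemma l2_0P : l2_summable (fun=> 0).
Proof.
apply/l2_summableP => eps e0; near=> n => x.
rewrite big1 ?ltW// => k _; rewrite [X in normR X](_ : _ = 0)//.
by rewrite normR0 expr0n.
Unshelve. all: by end_near. Qed.

Lemma l2_addP (xi eta : l2) : l2_summable (fun k => xi k + eta k).
Proof.
apply: (@l2_dominated xi eta _ 2) => //; [exact: l2P|exact: l2P|move=> k x].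
apply: (@le_trans _ _ ((normR (xi k x) + normR (eta k x)) ^+ 2)).
  rewrite lerXn2r ?nnegrE ?addr_ge0 ?normR_ge0//.
  exact: (ler_normRD (xi k x) (eta k x)).
rewrite -subr_ge0; set u := normR (xi k x); set v := normR (eta k x).
by rewrite [leRHS](_ : _ = (u - v) ^+ 2) ?sqr_ge0//; ring.
Qed.

Lemma l2_scaleP (a : A) (xi : l2) : l2_summable (fun k => a * xi k).
Proof.
have a1 : 0 < CX_supnorm a ^+ 2 + 1 by rewrite ltr_wpDl ?sqr_ge0.
apply: (@l2_dominated xi (fun=> 0) _ _ a1 (@l2P xi) l2_0P) => k x.
rewrite [X in normR X](_ : _ = a x * xi k x)// normRM exprMn.
rewrite [X in _ + normR X ^+ 2](_ : _ = 0)// normR0 expr0n/= addr0.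
rewrite ler_wpM2r ?sqr_ge0// ler_wpDr// lerXn2r ?nnegrE ?normR_ge0//.
  exact: CX_supnorm_ge0.
exact: CX_le_supnorm.
Qed.

Definition l2_zero := MkL2 l2_0P.
Definition l2_add (xi eta : l2) := MkL2 (@l2_addP xi eta).
Definition l2_scale (a : A) (xi : l2) := MkL2 (@l2_scaleP a xi).
Definition l2_opp (xi : l2) := l2_scale (-1) xi.

Lemma l2_addA : associative l2_add.
Proof. by move=> f g h; apply: l2_eqP => k; exact: addrA. Qed.
Lemma l2_addC : commutative l2_add.
Proof. by move=> f g; apply: l2_eqP => k; exact: addrC. Qed.
Lemma l2_add0 : left_id l2_zero l2_add.
Proof. by move=> f; apply: l2_eqP => k; exact: add0r. Qed.
Lemma l2_addN : left_inverse l2_zero l2_opp l2_add.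
Proof. by move=> f; apply: l2_eqP => k /=; rewrite mulN1r addNr. Qed.

HB.instance Definition _ :=
  GRing.isZmodule.Build l2 l2_addA l2_addC l2_add0 l2_addN.

Lemma l2_scaleA a b xi : l2_scale a (l2_scale b xi) = l2_scale (a * b) xi.
Proof. by apply: l2_eqP => k; exact: mulrA. Qed.
Lemma l2_scale1 : left_id 1 l2_scale.
Proof. by move=> xi; apply: l2_eqP => k; exact: mul1r. Qed.
Lemma l2_scaleDr : right_distributive l2_scale +%R.
Proof. by move=> a f g; apply: l2_eqP => k; exact: mulrDr. Qed.
Lemma l2_scaleDl xi : {morph l2_scale^~ xi : a b / a + b}.
Proof. by move=> a b; apply: l2_eqP => k; exact: mulrDl. Qed.

HB.instance Definition _ := GRing.Zmodule_isLmodule.Build A l2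
  l2_scaleA l2_scale1 l2_scaleDr l2_scaleDl.

Definition l2_norm (xi : l2) : R :=
  Num.sqrt (normR (limn (series (fun k => xi k * CX_star (xi k))))).

End l2.

Section operators.
Variable R : realType.
Variables (U V : Type) (nU : U -> R) (nV : V -> R).

Definition bounded_op (T : U -> V) : Prop :=
  exists C : R, forall u, nV (T u) <= C * nU u.

(* only meaningful when T is bounded: the sup of an unbounded set is 0 *)
Definition opnorm (T : U -> V) : R :=
  sup [set nV (T u) | u in [set u | nU u <= 1]].

End operators.

(* Hilbert (left) modules over C(X); an element of C(X) is positive iff its
   values are nonnegative. *)
HB.mixin Record isHilbertModule (R : realType) (X : compactHausdorffType) M
    & GRing.Lmodule (CX R X) M := {
  hm_dot : M -> M -> CX R X;
  hm_dotP : forall (a : CX R X) (u v w : M),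
    hm_dot (a *: u + v) w = a * hm_dot u w + hm_dot v w;
  hm_dotC : forall u v : M, hm_dot v u = CX_star (hm_dot u v);
  hm_dot_ge0 : forall (u : M) x, 0 <= hm_dot u u x;
  hm_dot_eq0 : forall u : M, hm_dot u u = 0 -> u = 0;
  hm_complete : forall u : nat -> M,
    (forall eps : R, 0 < eps -> exists N, forall m n, (N <= m)%N -> (N <= n)%N ->
       Num.sqrt (normR (hm_dot (u m - u n) (u m - u n))) < eps) ->
    exists l, Num.sqrt (normR (hm_dot (u n - l) (u n - l))) @[n --> \oo] --> (0 : R)
}.

#[short(type="hilbertModType")]
HB.structure Definition HilbertModule (R : realType) (X : compactHausdorffType) :=
  {M of GRing.Lmodule (CX R X) M & isHilbertModule R X M}.

Section A_operators.
Variables (R : realType) (X : compactHausdorffType).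
Local Notation A := (CX R X).
Local Notation l2A := (l2 R X).

Definition hm_norm (M : hilbertModType R X) (u : M) : R :=
  Num.sqrt (normR (hm_dot u u)).

Definition alg_fin_gen (M : lmodType A) : Prop :=
  exists (n : nat) (g : 'I_n -> M), forall u : M,
    exists c : 'I_n -> A, u = \sum_(i < n) c i *: g i.

Definition fin_gen_Aop (F : {linear l2A -> l2A}) : Prop :=
  exists (M : hilbertModType R X) (P : {linear l2A -> M}) (T : {linear M -> l2A}),
    [/\ alg_fin_gen M, bounded_op (@l2_norm R X) (@hm_norm M) P,
        bounded_op (@hm_norm M) (@l2_norm R X) T & F =1 T \o P].

Definition compact_Aop (K : {linear l2A -> l2A}) : Prop :=
  bounded_op (@l2_norm R X) (@l2_norm R X) K /\
  forall eps : R, 0 < eps -> exists2 F : {linear l2A -> l2A},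
    fin_gen_Aop F & opnorm (@l2_norm R X) (@l2_norm R X) (K \- F) < eps.

End A_operators.

HB.mixin Record isHilbertSpace (R : realType) H
    & CompleteNormedModule R[i] H := {
  hdot : {dot H for Num.Def.conjC};
  hdot_normE : forall u : H, `|u| ^+ 2 = hdot u u
}.

#[short(type="hilbertType")]
HB.structure Definition HilbertSpace (R : realType) :=
  {H of CompleteNormedModule R[i] H & isHilbertSpace R H}.

(* The k-th basis vector is e_(k+1) in one-based notation. *)
Record orthonormal_basis (R : realType) (H : hilbertType R) := OrthonormalBasis {
  onb :> nat -> H;
  onbE : forall i j, hdot (onb i) (onb j) = (i == j)%:R;
  onb_dense : dense [set u : H | exists (n : nat) (c : nat -> R[i]),
                       u = \sum_(k < n) c k *: onb k]
}.

Section Hilbert.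
Variables (R : realType) (H : hilbertType R) (e : orthonormal_basis H).

(* orthogonal projection onto the orthogonal complement of the span of the
   first n basis vectors, see proj_perp_orth *)
Definition proj_perp (n : nat) (a : H) : H :=
  a - \sum_(k < n) hdot a (e k) *: e k.

Lemma hdotC (u v : H) : hdot u v = Num.conj (hdot v u).
Proof. by rewrite hermC expr0 mul1r. Qed.

Lemma hdot_sumZl n (c : nat -> R[i]) (f : nat -> H) v :
  hdot (\sum_(k < n) c k *: f k) v = \sum_(k < n) c k * hdot (f k) v.
Proof.
rewrite (big_morph (fun u => hdot u v) (fun _ _ => linearDl _ _ _ _) (linear0l _ _)).
by apply: eq_bigr => k _; rewrite linearZl_LR.
Qed.

Lemma proj_perp_orth n a k : (k < n)%N -> hdot (proj_perp n a) (e k) = 0.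
Proof.
move=> kn; rewrite /proj_perp linearBl/= (hdot_sumZl _ (fun k => hdot a (e k))).
rewrite (bigD1 (Ordinal kn))//= big1 => [|i ik].
  by rewrite addr0 onbE eqxx mulr1 subrr.
rewrite onbE; move: ik; rewrite -val_eqE/= => /negPf ->.
by rewrite mulr0.
Qed.

Lemma bessel n a :
  \sum_(k < n) normR (hdot a (e k)) ^+ 2 = normR a ^+ 2 - normR (proj_perp n a) ^+ 2.
Proof.
apply: complexI; rewrite rmorphB rmorph_sum/= !rmorphXn/= -!normRE !hdot_normE.
rewrite [X in _ - X](_ : _ = hdot (proj_perp n a) a); last first.
  rewrite {2}/proj_perp linearBr/= [X in _ - X](_ : _ = 0) ?subr0//.
  rewrite hdotC (hdot_sumZl _ (fun k => hdot a (e k))) big1 ?rmorph0// => k _.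
  by rewrite (hdotC (e k)) proj_perp_orth// rmorph0 mulr0.
rewrite {1}/proj_perp linearBl/= (hdot_sumZl _ (fun k => hdot a (e k))).
rewrite opprB addrC subrK.
apply: eq_bigr => k _; rewrite rmorphXn/= -normRE normCK.
by rewrite (hdotC (e k)).
Qed.

Lemma normR_proj_perp n a : normR (proj_perp n a) <= normR a.
Proof.
rewrite -(@ler_pXn2r _ 2) ?nnegrE ?normR_ge0// -subr_ge0 -bessel.
by apply: sumr_ge0 => k _; rewrite sqr_ge0.
Qed.

Lemma onb_series_cvg a : series (fun k => hdot a (e k) *: e k) @ \oo --> a.
Proof.
apply/normR_cvgP => eps e0.
have [b [ba [m [c bE]]]] : (ball a eps%:C `&`
    [set u : H | exists (n : nat) (c : nat -> R[i]),
                   u = \sum_(k < n) c k *: e k]) !=set0.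
  apply: (onb_dense e); last by apply: ball_open; rewrite ltcR.
  by exists a; apply: ballxx; rewrite ltcR.
near=> n; rewrite /series/= big_mkord -/(proj_perp n a).
suff -> : proj_perp n a = proj_perp n (a - b).
  apply: le_lt_trans (normR_proj_perp _ _) _.
  by move: ba; rewrite -ball_normE/= normRE ltcR.
have mn : (m <= n)%N by near: n; exists m.
have bn : \sum_(k < n) hdot b (e k) *: e k = b.
  rewrite {2}bE (big_ord_widen n (fun k => c k *: e k) mn) [RHS]big_mkcond/=.
  apply: eq_bigr => k _; rewrite bE (hdot_sumZl _ c e).
  case: ifP => km.
    rewrite (bigD1 (Ordinal km))//= big1 => [|i ik].
      by rewrite addr0 onbE eqxx mulr1.
    by rewrite onbE; move: ik; rewrite -val_eqE/= => /negPf ->; rewrite mulr0.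
  rewrite big1 ?scale0r// => i _; rewrite onbE.
  have /negPf -> : (i : nat) != k by apply: contraFN km => /eqP <-.
  by rewrite mulr0.
rewrite /proj_perp.
under [in RHS]eq_bigr do rewrite linearBl/= scalerBl.
by rewrite sumrB bn opprB addrA subrK.
Unshelve. all: by end_near. Qed.

Variable X : compactHausdorffType.

Lemma l2_cstP (a : H) : l2_summable (fun k => CX_cst X (hdot a (e k))).
Proof.
apply/l2_summableP => eps e0.
have : cvgn (series (fun k => normR (hdot a (e k)) ^+ 2)).
  apply: nondecreasing_is_cvgn.
    by apply: nondecreasing_series => k _ _; rewrite sqr_ge0.
  exists (normR a ^+ 2) => _ [n _ <-].
  by rewrite /series/= big_mkord bessel gerBl sqr_ge0.
move=> /cauchy_cvgP/cauchy_seriesP/(_ _ e0); apply: filterS => n nx x.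
exact: le_trans (ler_norm _) (ltW nx).
Qed.

(* the constant map with value a, as an element of l2 *)
Definition l2_cst (a : H) : l2 R X := MkL2 (@l2_cstP a).

(* the map X -> H identified with an element of l2 *)
Definition l2_fun (xi : l2 R X) (x : X) : H :=
  limn (series (fun k => xi k x *: e k)).

Lemma l2_fun_cst a x : l2_fun (l2_cst a) x = a.
Proof. by apply: cvg_lim => //; exact: onb_series_cvg. Qed.

(* the operator-valued function D(B) : X -> B(H) of a bounded C(X)-operator B *)
Definition DD (B : l2 R X -> l2 R X) (x : X) (a : H) : H :=
  l2_fun (B (l2_cst a)) x.

End Hilbert.

Section IM.
Variables (R : realType) (H : hilbertType R).

Definition compact_op (B : H -> H) : Prop :=
  linear B /\ precompact (B @` [set u | `|u| <= 1]).

Record compactOp := CompactOp { cop :> H -> H; copP : compact_op cop }.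

Definition inGL (S : {linear H -> H}) : Prop :=
  bounded_op (@normR R H) (@normR R H) S /\
  exists T : {linear H -> H},
    [/\ bounded_op (@normR R H) (@normR R H) T, cancel S T & cancel T S].

Variable e : orthonormal_basis H.

(* the subbasic sets U_(eps, a_1, ..., a_n, K), with s the list of the a_i *)
Definition IM_vec (eps : R) (s : seq H) (K : compactOp) : set compactOp :=
  [set B : compactOp | forall a, a \in s -> normR (B a - K a) < eps].

(* U_(eps, n, S, K); T is the invertible operator called R in the usual
   notation, R being the real field here *)
Definition IM_GLn (eps : R) (n : nat) (S : {linear H -> H}) (K : compactOp) :
    set compactOp :=
  [set B : compactOp | exists2 T : {linear H -> H}, inGL T &
     opnorm (@normR R H) (@normR R H)
       (fun a => T (S a + proj_perp e n (B a)) -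
                 (S a + proj_perp e n (K a))) < eps].

(* U_(eps, S, K) *)
Definition IM_GL (eps : R) (S : {linear H -> H}) (K : compactOp) :
    set compactOp :=
  \bigcap_n IM_GLn eps n S K.

Definition IM_subbase : set (set compactOp) :=
  [set W | (exists eps s K, 0 < eps /\ W = IM_vec eps s K) \/
           (exists eps S K, [/\ 0 < eps, inGL S & W = IM_GL eps S K])].

End IM.

(* K(H) with the IM-topology *)
Definition IMspace (R : realType) (H : hilbertType R)
  (e : orthonormal_basis H) : Type := compactOp H.

Section IM_topology.
Variables (R : realType) (H : hilbertType R) (e : orthonormal_basis H).

HB.instance Definition _ := gen_eqMixin (IMspace e).
HB.instance Definition _ := gen_choiceMixin (IMspace e).
HB.instance Definition _ :=
  isSubBaseTopological.Build (IMspace e) (IM_subbase e) id.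

End IM_topology.

(* Main.v *)
(* Write K_x for D(K)(x) and Q_n for the projection onto L_n^perp. Both sides of
   the equivalence say that the tails of K are uniformly small: for every
   eps > 0 there is an n with |Q_n K_x| <= eps for all x.

   Compactness. K is the norm limit of the P_n K as soon as its tails are uniformly
   small, because (K xi)(x) = K_x (xi(x)). Conversely a finitely generated
   operator T P has uniformly small tails: T u is a combination of finitely many
   T g_i, and uniform boundedness on the module bounds Q_n T by the tails of
   the T g_i.

   IM-continuity of K with small tails. Up to tails only P_N K_y matters, which
   converges to P_N K_x only strongly as y -> x; an explicit unipotent operator
   moves S + Q_n P_N K_y close to S + Q_n P_N K_x, see IM_perturb.

   Small tails from IM-continuity. Otherwise a gliding hump argument gives points
   y_j, indices n_j -> oo and orthonormal u_j such that v_j = Q_(n_j) K_(y_j) u_j has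
   |<v_j, u_j>| bounded below, and an invertible S with S u_j = - v_j. Hence
   S + Q_(n_j) K_(y_j) kills u_j, whereas for a cluster point z of the y_j,
   S + Q_n K_z is close to S for large n, so that no invertible factor brings the
   former close to the latter. *)

Require Import Defs.
From HB Require Import structures.
From mathcomp Require Import all_boot all_order all_algebra.
From mathcomp Require Import sesquilinear complex.
From mathcomp Require Import all_classical all_reals all_analysis.
From mathcomp Require Import ring lra.

Import Order.TTheory GRing.Theory Num.Theory.
Import numFieldNormedType.Exports.

Local Open Scope classical_set_scope.
Local Open Scope ring_scope.

Set Implicit Arguments.
Unset Strict Implicit.
Unset Printing Implicit Defensive.

(** * Hilbert space geometry *)

Section Hilbert_geometry.
Context {R : realType}.

Lemma normRC (r : R) : normR r%:C%C = `|r|.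
Proof. by rewrite /normR normc_def/= expr0n/= addr0 sqrtr_sqr. Qed.

Lemma normR1 : normR (1 : R[i]) = 1.
Proof. by rewrite -[1 in LHS](rmorph1 (real_complex R)) normRC normr1. Qed.

Lemma normRV (c : R[i]) : normR c^-1 = (normR c)^-1.
Proof.
have [->|c0] := eqVneq c 0; first by rewrite invr0 normR0 invr0.
have nc0 : normR c != 0 by apply: contra c0 => /eqP/normR0_eq0 ->.
by apply: (mulfI nc0); rewrite -normRM !divff// normR1.
Qed.

Lemma normR_sum (V : normedZmodType R[i]) (I : Type) (s : seq I) (P : pred I)
    (f : I -> V) :
  normR (\sum_(i <- s | P i) f i) <= \sum_(i <- s | P i) normR (f i).
Proof.
elim/big_rec2: _ => [|i x y _ xy]; first by rewrite normR0.
exact: le_trans (ler_normRD _ _) (lerD _ _).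
Qed.

Lemma normRZ (V : normedModType R[i]) (c : R[i]) (v : V) :
  normR (c *: v) = normR c * normR v.
Proof. by apply: complexI; rewrite rmorphM/= -!normRE normrZ. Qed.

Lemma ler_normRB (V : normedZmodType R[i]) (u v : V) :
  normR (u - v) <= normR u + normR v.
Proof. by rewrite -(normRN v) ler_normRD. Qed.

Lemma normR_le_add (V : normedZmodType R[i]) (u v : V) :
  normR u <= normR v + normR (u - v).
Proof. by rewrite -{1}(subrK v u) addrC ler_normRD. Qed.

Lemma cvg_normR_le (V : normedModType R[i]) (T : Type) (F : set_system T)
    {FF : ProperFilter F} (f : T -> V) (y : V) (c : R) :
  f @ F --> y -> (\forall t \near F, normR (f t) <= c) -> normR y <= c.
Proof.
move=> /normR_cvgP fy fc; apply/ler_addgt0Pr => eps /fy fe.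
have [t [tc te]] := filter_ex (filterI fc fe).
by apply: le_trans (normR_le_add y (f t)) _; rewrite lerD// ltW.
Qed.

(** Cauchy criterion restricted to [m <= n]: for [n < m] the sum is empty. *)
Lemma cvg_series_normR (V : completeNormedModType R[i]) (f : nat -> V) :
  (forall eps : R, 0 < eps -> exists N, forall m n, (N <= m <= n)%N ->
     normR (\sum_(m <= k < n) f k) < eps) ->
  cvgn (series f).
Proof.
move=> fc; apply/cauchy_cvgP/cauchy_seriesP => eps e0.
have er : (complex.Re eps)%:C%C = eps by rewrite RRe_real// gtr0_real.
have {}/fc[N Nf] : 0 < complex.Re eps by rewrite -ltcR er.
exists ([set n | N <= n], [set n | N <= n])%N; first by split; exists N.
move=> [m n] /= [Nm Nn]; rewrite -er normRE ltcR.
have [mn|nm] := leqP m n; first by rewrite Nf// Nm.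
by rewrite big_geq ?(ltnW nm)// normR0 -ltcR er.
Qed.

Variable H : hilbertType R.
Implicit Types u v w : H.

Lemma sqr_normRE u : (normR u ^+ 2)%:C%C = hdot u u.
Proof. by rewrite rmorphXn/= -normRE hdot_normE. Qed.

Lemma hdotDl u v w : hdot (u + v) w = hdot u w + hdot v w.
Proof. exact: linearDl. Qed.
Lemma hdotBl u v w : hdot (u - v) w = hdot u w - hdot v w.
Proof. exact: linearBl. Qed.
Lemma hdotDr u v w : hdot u (v + w) = hdot u v + hdot u w.
Proof. exact: linearDr. Qed.
Lemma hdotZl c u v : hdot (c *: u) v = c * hdot u v.
Proof. exact: linearZl_LR. Qed.
Lemma hdotZr c u v : hdot u (c *: v) = Num.conj c * hdot u v.
Proof. exact: linearZr_LR. Qed.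
Lemma hdot0l u : hdot 0 u = 0. Proof. exact: linear0l. Qed.
Lemma hdot0r u : hdot u 0 = 0. Proof. exact: linear0r. Qed.
Lemma hdot_suml (I : Type) (s : seq I) (P : pred I) (f : I -> H) v :
  hdot (\sum_(i <- s | P i) f i) v = \sum_(i <- s | P i) hdot (f i) v.
Proof. exact: (big_morph (fun u => hdot u v) (fun _ _ => hdotDl _ _ _) (hdot0l _)). Qed.

Lemma hdot_eq0C u v : hdot u v = 0 -> hdot v u = 0.
Proof. by rewrite hdotC => /eqP; rewrite conjC_eq0 => /eqP ->. Qed.

Lemma sqr_normRD_orth u v : hdot u v = 0 ->
  normR (u + v) ^+ 2 = normR u ^+ 2 + normR v ^+ 2.
Proof.
move=> uv; apply: complexI; rewrite rmorphD/= !sqr_normRE hdotDl !hdotDr.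
by rewrite uv (hdot_eq0C uv) addr0 add0r.
Qed.

Lemma sqr_normR_sum_orth (g : nat -> H) m n :
  (forall i j, i != j -> hdot (g i) (g j) = 0) ->
  normR (\sum_(m <= k < n) g k) ^+ 2 = \sum_(m <= k < n) normR (g k) ^+ 2.
Proof.
move=> go; have [mn|nm] := leqP m n; last first.
  by rewrite !big_geq ?(ltnW nm)// normR0 expr0n.
elim: n mn => [|n IH]; first by rewrite leqn0 => /eqP ->; rewrite !big_geq// normR0 expr0n.
rewrite leq_eqVlt => /predU1P[->|mn]; first by rewrite !big_geq// normR0 expr0n.
rewrite !big_nat_recr//= sqr_normRD_orth ?IH// hdot_suml big_nat_cond big1// => i.
by rewrite andbT => /andP[_ lin]; apply: go; rewrite ltn_eqF.
Qed.

(** Cauchy-Schwarz: with [c *: v] the orthogonal projection of [u] on [v], Pythagoras gives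
    [normR (c *: v) <= normR u]. *)
Lemma normR_hdot_le u v : normR (hdot u v) <= normR u * normR v.
Proof.
have [->|v0] := eqVneq v 0; first by rewrite hdot0r !normR0 mulr0.
have nv0 : normR v != 0 by apply: contra v0 => /eqP/normR0_eq0 ->.
have vv0 : hdot v v != 0.
  rewrite -sqr_normRE; apply: contra nv0 => /eqP/complexI/eqP.
  by rewrite expf_eq0.
set c := hdot u v / hdot v v.
have wv : hdot (u - c *: v) (c *: v) = 0.
  by rewrite hdotZr hdotBl hdotZl /c divfK// subrr mulr0.
have := sqr_normRD_orth wv; rewrite subrK normRZ => uE.
have : (normR c * normR v) ^+ 2 <= normR u ^+ 2.
  by rewrite uE lerDr sqr_ge0.
rewrite ler_pXn2r ?nnegrE ?mulr_ge0 ?normR_ge0// => h.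
have -> : normR (hdot u v) = normR c * normR v * normR v.
  have -> : hdot u v = c * hdot v v by rewrite /c divfK.
  by rewrite normRM -sqr_normRE normRC ger0_norm ?sqr_ge0// expr2 mulrA.
by rewrite ler_wpM2r// normR_ge0.
Qed.

Lemma cvg_hdot (T : Type) (F : set_system T) {FF : ProperFilter F} (f : T -> H)
    y v c :
  f @ F --> y -> (\forall t \near F, hdot (f t) v = c) -> hdot y v = c.
Proof.
move=> /normR_cvgP fy fc; apply/eqP; rewrite -subr_eq0; apply/eqP.
apply: normR0_eq0; apply/eqP; rewrite eq_le normR_ge0 andbT.
apply/ler_addgt0Pr => eps e0; rewrite add0r.
have v1 : 0 < normR v + 1 by rewrite ltr_wpDl ?normR_ge0.
have /fy fe : 0 < eps / (normR v + 1) by rewrite divr_gt0.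
have [t [<- te]] := filter_ex (filterI fc fe).
rewrite -hdotBl (le_trans (normR_hdot_le _ _))//.
rewrite (@le_trans _ _ (normR (y - f t) * (normR v + 1)))//.
  by rewrite ler_wpM2l ?normR_ge0// lerDl.
by rewrite -ler_pdivlMr// ltW.
Qed.

(** By Pythagoras the Cauchy criterion reduces to the real series of squared norms, which is
    increasing and bounded. *)
Lemma orth_series_cvg (g : nat -> H) (c : R) :
  (forall i j, i != j -> hdot (g i) (g j) = 0) ->
  (forall n, \sum_(0 <= k < n) normR (g k) ^+ 2 <= c) ->
  cvgn (series g).
Proof.
move=> go gc; apply: cvg_series_normR => eps e0.
have : cvgn (series (fun k => normR (g k) ^+ 2)).
  apply: nondecreasing_is_cvgn.
    by apply: nondecreasing_series => k _ _; rewrite sqr_ge0.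
  by exists c => _ [n _ <-]; exact: gc.
move=> /cauchy_cvgP/cauchy_seriesP/(_ (eps ^+ 2)); rewrite exprn_gt0//.
move=> /(_ isT) [[/= P Q] [[N1 _ N1P] [N2 _ N2Q]] PQ].
exists (maxn N1 N2) => m n /andP[]; rewrite geq_max => /andP[N1m N2m] mn.
have := PQ (m, n) (conj (N1P _ N1m) (N2Q _ (leq_trans N2m mn))) => /=.
rewrite -sqr_normR_sum_orth// ger0_norm ?sqr_ge0//.
by rewrite ltr_pXn2r ?nnegrE ?normR_ge0// ltW.
Qed.

Lemma orth_series_le (g : nat -> H) (c : R) : 0 <= c ->
  (forall i j, i != j -> hdot (g i) (g j) = 0) ->
  (forall n, \sum_(0 <= k < n) normR (g k) ^+ 2 <= c ^+ 2) ->
  normR (limn (series g)) <= c.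
Proof.
move=> c0 go gc; apply: (cvg_normR_le (orth_series_cvg go gc)).
near=> n; rewrite -(@ler_pXn2r _ 2)// ?nnegrE ?normR_ge0//.
by rewrite /series/= sqr_normR_sum_orth.
Unshelve. all: by end_near. Qed.

End Hilbert_geometry.

(** * Coordinates and the identification of l2 with maps into H *)

Section Coordinates.
Context {R : realType} {H : hilbertType R}.
Variable e : orthonormal_basis H.
Implicit Types a b : H.
Local Notation Q := (proj_perp e).

Lemma onb_ext a b : (forall k, hdot a (e k) = hdot b (e k)) -> a = b.
Proof.
move=> ab; have := @onb_series_cvg _ _ e b.
under eq_fun do rewrite -ab.
move=> /(cvg_lim (@norm_hausdorff _ _)) <-.
exact/esym/(cvg_lim (@norm_hausdorff _ _))/onb_series_cvg.
Qed.

Lemma hdot_proj_perp n a k :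
  hdot (Q n a) (e k) = if (k < n)%N then 0 else hdot a (e k).
Proof.
case: ifPn => [kn|]; first exact: proj_perp_orth.
rewrite -leqNgt => nk; rewrite /proj_perp hdotBl hdot_suml big1 ?subr0// => i _.
by rewrite hdotZl onbE ltn_eqF ?mulr0// (leq_trans (ltn_ord i)).
Qed.

Lemma proj_perpP n : linear (Q n).
Proof.
move=> c a b; apply: onb_ext => k; rewrite [RHS]hdotDl [in RHS]hdotZl !hdot_proj_perp.
by case: ifP => _; rewrite ?mulr0 ?addr0// hdotDl hdotZl.
Qed.

HB.instance Definition _ n :=
  GRing.isLinear.Build R[i] H H _ (Q n) (proj_perpP n).

Lemma proj_perp_maxn m n a : Q m (Q n a) = Q (maxn m n) a.
Proof.
apply: onb_ext => k; rewrite !hdot_proj_perp leq_max.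
by case: ltnP => //=.
Qed.

(** The ranges of $Q_n$ and $1-Q_n$ are orthogonal, so both sides equal $\langle
    Q_na,Q_nb\rangle$. *)
Lemma hdot_proj_perpC n a b : hdot (Q n a) b = hdot a (Q n b).
Proof.
have oQ c d : hdot (Q n c) (d - Q n d) = 0.
  rewrite opprB addrC subrK; apply: hdot_eq0C; rewrite hdot_suml big1// => k _.
  by rewrite hdotZl (hdotC (e k)) hdot_proj_perp ltn_ord rmorph0 mulr0.
rewrite -{1}(subrK (Q n b) b) [LHS]hdotDr oQ add0r -{2}(subrK (Q n a) a) [RHS]hdotDl.
by rewrite (hdot_eq0C (oQ b a)) add0r.
Qed.

Lemma normR_proj_perp_le m n a : (m <= n)%N -> normR (Q n a) <= normR (Q m a).
Proof. by move=> /maxn_idPl <-; rewrite -proj_perp_maxn normR_proj_perp. Qed.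

Lemma proj_perp_cvg0 a (eps : R) : 0 < eps ->
  exists N, forall n, (N <= n)%N -> normR (Q n a) < eps.
Proof.
move=> e0; have /normR_cvgP/(_ _ e0) [N _ NP] := @onb_series_cvg _ _ e a.
by exists N => n /NP; rewrite /series/= big_mkord.
Qed.

Lemma sqr_normR_proj_perp m n a : (m <= n)%N ->
  normR (Q m a) ^+ 2 =
  \sum_(m <= k < n) normR (hdot a (e k)) ^+ 2 + normR (Q n a) ^+ 2.
Proof.
move=> mn; have := @bessel _ _ e n a; have := @bessel _ _ e m a.
rewrite -!(big_mkord xpredT (fun k => normR (hdot a (e k)) ^+ 2)).
rewrite (@big_cat_nat _ _ _ m 0 n)//= => -> h; lra.
Qed.

Variable X : compactHausdorffType.
Implicit Types xi eta : l2 R X.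

Lemma onb_scale_orth (c : nat -> R[i]) i j : i != j ->
  hdot (c i *: e i) (c j *: e j) = 0.
Proof. by move=> /negPf ij; rewrite hdotZl hdotZr onbE ij !mulr0. Qed.

Lemma normR_onb k : normR (e k) = 1.
Proof.
apply/eqP; rewrite -(@eqrXn2 _ 2) ?normR_ge0// expr1n; apply/eqP/complexI.
by rewrite sqr_normRE onbE eqxx.
Qed.

(** Justifies the [limn] in [l2_fun]: by Pythagoras the partial sums inherit the Cauchy property of
    [l2_summableP]. *)
Lemma l2_fun_cvg xi x : series (fun k => xi k x *: e k) @ \oo --> l2_fun e xi x.
Proof.
apply: cvg_series_normR => eps e0.
have e2 : 0 < eps ^+ 2 / 2 by rewrite divr_gt0// exprn_gt0.
have /l2_summableP/(_ _ e2) := @l2P _ _ xi.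
move=> [[/= A B] [[N1 _ N1A] [N2 _ N2B]] AB].
exists (maxn N1 N2) => m n /andP[]; rewrite geq_max => /andP[N1m N2m] mn.
have := AB (m, n) (conj (N1A _ N1m) (N2B _ (leq_trans N2m mn))) x => /= h.
rewrite -(@ltr_pXn2r _ 2) ?nnegrE ?normR_ge0 ?(ltW e0)//.
rewrite sqr_normR_sum_orth; last exact: onb_scale_orth.
under eq_bigr do rewrite normRZ normR_onb mulr1.
apply: le_lt_trans h _.
by rewrite gtr_pMr ?invf_lt1 ?ltr1n ?exprn_gt0.
Qed.

Lemma hdot_l2_fun xi x k : hdot (l2_fun e xi x) (e k) = xi k x.
Proof.
apply: (cvg_hdot (@l2_fun_cvg xi x)); near=> n.
have kn : (k < n)%N by near: n; exists k.+1.
rewrite /series/= hdot_suml big_mkord (bigD1 (Ordinal kn))//= big1 => [|i ik].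
  by rewrite addr0 hdotZl onbE eqxx mulr1.
by rewrite hdotZl onbE; move: ik; rewrite -val_eqE/= => /negPf ->; rewrite mulr0.
Unshelve. all: by end_near. Qed.

Lemma l2_funD xi eta x : l2_fun e (xi + eta) x = l2_fun e xi x + l2_fun e eta x.
Proof. by apply: onb_ext => k; rewrite hdotDl !hdot_l2_fun. Qed.

Lemma l2_funZ (f : CX R X) xi x : l2_fun e (f *: xi) x = f x *: l2_fun e xi x.
Proof. by apply: onb_ext => k; rewrite hdotZl !hdot_l2_fun. Qed.

Lemma l2_fun0 x : l2_fun e (0 : l2 R X) x = 0.
Proof. by apply: onb_ext => k; rewrite hdot0l hdot_l2_fun. Qed.

Lemma l2_funB xi eta x : l2_fun e (xi - eta) x = l2_fun e xi x - l2_fun e eta x.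
Proof.
by apply/eqP; rewrite eq_sym subr_eq -l2_funD subrK.
Qed.

Lemma l2_fun_ext xi eta : (forall x, l2_fun e xi x = l2_fun e eta x) -> xi = eta.
Proof. by move=> h; apply: l2_eqP => k; apply: CXP => x; rewrite -!hdot_l2_fun h. Qed.

Lemma l2_tail xi (eps : R) : 0 < eps ->
  exists N, forall n x, (N <= n)%N -> normR (Q n (l2_fun e xi x)) <= eps.
Proof.
move=> e0; have e2 : 0 < eps ^+ 2 / 2 by rewrite divr_gt0// exprn_gt0.
have /l2_summableP/(_ _ e2) := @l2P _ _ xi.
move=> [[/= A B] [[N1 _ N1A] [N2 _ N2B]] AB].
exists (maxn N1 N2) => m x; rewrite geq_max => /andP[N1m N2m].
have e4 : 0 < eps / 2 by rewrite divr_gt0.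
(* This [N] depends on [x], but the Cauchy bound is uniform in [x] and in the upper index, so the
   threshold for [m] does not. *)
have [N NP] := proj_perp_cvg0 (l2_fun e xi x) e4.
pose n := maxn N m; have mn : (m <= n)%N by rewrite leq_maxr.
have := AB (m, n) (conj (N1A _ N1m) (N2B _ (leq_trans N2m mn))) x => /= h.
rewrite -(@ler_pXn2r _ 2) ?nnegrE ?normR_ge0 ?(ltW e0)//.
rewrite (sqr_normR_proj_perp _ mn).
under eq_bigr do rewrite hdot_l2_fun.
apply: le_trans (_ : _ <= eps ^+ 2 / 2 + (eps / 2) ^+ 2) _.
  rewrite lerD// lerXn2r ?nnegrE ?normR_ge0 ?(ltW e4)//.
  exact/ltW/NP/leq_maxl.
by nra.
Qed.

(** The tails are small at both points, and the finitely many remaining coordinates are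
    continuous. *)
Lemma l2_fun_continuous xi : continuous (l2_fun e xi).
Proof.
move=> x; apply/normR_cvgP => eps e0; have e4 : 0 < eps / 4 by rewrite divr_gt0.
have [N NP] := l2_tail xi e4.
have : \forall y \near x, forall k : 'I_N, normR (xi k x - xi k y) <= eps / 4 / N.+1%:R.
  apply: filter_forall => k; have eN : 0 < eps / 4 / N.+1%:R by rewrite divr_gt0.
  have /normR_cvgP/(_ _ eN) := @CX_cts R X (xi k) x; apply: filterS => y; exact: ltW.
apply: filterS => y xy; set b := l2_fun _ _ _ - _.
have bQ : normR (Q N b) <= eps / 4 + eps / 4.
  by rewrite linearB/= (le_trans (ler_normRB _ _))// lerD// NP.
have bP : normR (b - Q N b) <= eps / 4.
  rewrite opprB addrC subrK (le_trans (normR_sum _ _ _))//.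
  apply: (@le_trans _ _ (\sum_(k < N) eps / 4 / N.+1%:R)).
    apply: ler_sum => k _; rewrite normRZ normR_onb mulr1 hdotBl !hdot_l2_fun.
    exact: xy.
  rewrite sumr_const card_ord -[leLHS]mulr_natr -mulrA ler_piMr ?(ltW e4)//.
  by rewrite ler_pdivrMl// mulr1 ler_nat.
have := normR_le_add b (Q N b).
by lra.
Qed.

(** The limit [L] in $C(X)$ is $x\mapsto\|\xi(x)\|^2$, hence [l2_norm] is the supremum norm on
    $[X,H]$. The condition [0 <= c] matters when [X] is empty. *)
Lemma l2_norm_leP xi (c : R) : 0 <= c ->
  l2_norm xi <= c <-> forall x, normR (l2_fun e xi x) <= c.
Proof.
move=> c0; rewrite /l2_norm; set L := limn _.
have Lc : series (fun k => xi k * CX_star (xi k)) @ \oo --> L by exact: l2P.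
have LE x : L x = (normR (l2_fun e xi x) ^+ 2)%:C%C.
  apply/eqP; rewrite -subr_eq0; apply/eqP/normR0_eq0/eqP.
  rewrite eq_le normR_ge0 andbT; apply/ler_addgt0Pr => eps e0; rewrite add0r.
  have e2 : 0 < eps / 2 by rewrite divr_gt0.
  have se : 0 < Num.sqrt (eps / 2) by rewrite sqrtr_gt0.
  have [N NP] := proj_perp_cvg0 (l2_fun e xi x) se.
  have /normR_cvgP/(_ _ e2) [M _ MP] := Lc.
  pose n := maxn N M; have := MP n (leq_maxr _ _).
  set s := series _ n => Ls.
  have /ltW h1 : normR (L x - s x) < eps / 2.
    by apply: le_lt_trans Ls; exact: (CX_le_supnorm (L - s) x).
  have sE : s x = (normR (l2_fun e xi x) ^+ 2 - normR (Q n (l2_fun e xi x)) ^+ 2)%:C%C.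
    rewrite -bessel rmorph_sum/= /s /series/= CX_sumE big_mkord; apply: eq_bigr => k _.
    by rewrite hdot_l2_fun rmorphXn/= -normRE normCK.
  have h2 : normR (s x - (normR (l2_fun e xi x) ^+ 2)%:C%C) <= eps / 2.
    rewrite sE -rmorphB/= normRC addrAC subrr add0r normrN ger0_norm ?sqr_ge0//.
    rewrite -[eps / 2]sqr_sqrtr ?(ltW e2)// lerXn2r ?nnegrE ?normR_ge0 ?(ltW se)//.
    by apply/ltW/NP/leq_maxl.
  rewrite -[_ - _](subrKA (s x)) (le_trans (ler_normRD _ _))//.
  by rewrite [leRHS](splitr eps) lerD.
have nL x : normR (L x) = normR (l2_fun e xi x) ^+ 2.
  by rewrite LE normRC ger0_norm ?sqr_ge0.
split=> [Lle x|h].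
  have : normR (L x) <= c ^+ 2.
    apply: le_trans (CX_le_supnorm L x) _; rewrite -(sqr_sqrtr (CX_supnorm_ge0 L)).
    by rewrite lerXn2r ?nnegrE ?sqrtr_ge0.
  by rewrite nL ler_pXn2r ?nnegrE ?normR_ge0.
rewrite -(ger0_norm c0) -sqrtr_sqr ler_wsqrtr//.
apply: CX_supnorm_le => [|x]; first exact: sqr_ge0.
by rewrite nL lerXn2r ?nnegrE ?normR_ge0.
Qed.

Lemma l2_norm_ge0 xi : 0 <= l2_norm xi.
Proof. exact: sqrtr_ge0. Qed.

Lemma normR_l2_fun_le xi x : normR (l2_fun e xi x) <= l2_norm xi.
Proof. by move: x; apply/(l2_norm_leP _ (l2_norm_ge0 xi)). Qed.

Lemma l2_norm_cst a : l2_norm (l2_cst e X a) <= normR a.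
Proof. by apply/l2_norm_leP => [|x]; rewrite ?normR_ge0// l2_fun_cst. Qed.

End Coordinates.

(** * Bounded operators and free Hilbert modules *)

Lemma CX_fun_sum (R : realType) (X : compactHausdorffType) (I : Type)
    (s : seq I) (P : pred I) (f : I -> CX R X) x :
  CX_fun (\sum_(i <- s | P i) f i) x = \sum_(i <- s | P i) f i x.
Proof. exact: CX_sumE. Qed.

Section Bounded_operators.
Context {R : realType} {U V : Type} {nU : U -> R} {nV : V -> R}.
Hypothesis nU0 : forall u, 0 <= nU u.

Lemma bounded_op_gt0 (T : U -> V) : bounded_op nU nV T ->
  exists2 C : R, 0 < C & forall u, nV (T u) <= C * nU u.
Proof.
move=> [C TC]; exists (`|C| + 1) => [|u]; first by rewrite ltr_wpDl.
by rewrite (le_trans (TC u))// ler_wpM2r// ler_wpDr// ler_norm.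
Qed.

Lemma opnorm_le (T : U -> V) (c : R) : (exists u, nU u <= 1) ->
  (forall u, nU u <= 1 -> nV (T u) <= c) -> opnorm nU nV T <= c.
Proof.
move=> [u0 u01] Tc; apply: ge_sup; first by exists (nV (T u0)), u0.
by move=> _ [u u1 <-]; exact: Tc.
Qed.

Lemma le_opnorm (T : U -> V) u : bounded_op nU nV T -> nU u <= 1 ->
  nV (T u) <= opnorm nU nV T.
Proof.
move=> /bounded_op_gt0[C C0 TC] u1; apply: ub_le_sup; last by exists u.
by exists C => _ [v v1 <-]; rewrite (le_trans (TC v))// ler_piMr// ltW.
Qed.

End Bounded_operators.

Lemma hm_norm_leP {R : realType} {X : compactHausdorffType}
    {M : hilbertModType R X} (u : M) (c : R) : 0 <= c ->
  hm_norm u <= c <-> forall x, normR (hm_dot u u x) <= c ^+ 2.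
Proof.
move=> c0; rewrite /hm_norm; split=> [h x|h].
  apply: le_trans (CX_le_supnorm _ x) _.
  by rewrite -(sqr_sqrtr (CX_supnorm_ge0 _)) lerXn2r ?nnegrE ?sqrtr_ge0.
rewrite -(ger0_norm c0) -sqrtr_sqr ler_wsqrtr//.
by apply: CX_supnorm_le; rewrite ?sqr_ge0.
Qed.

(** * The free module $\mathcal A^n$ with its standard inner product *)

Section Free_module.
Variables (R : realType) (X : compactHausdorffType) (n : nat).
Local Notation A := (CX R X).
Implicit Types u v w : 'rV[A]_n.

Definition rV_dot u v : A := \sum_i u 0 i * CX_star (v 0 i).

Lemma rV_dotE u x : rV_dot u u x = (\sum_i normR (u 0 i x) ^+ 2)%:C%C.
Proof.
rewrite /rV_dot CX_fun_sum rmorph_sum/=; apply: eq_bigr => i _.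
by rewrite rmorphXn/= -normRE normCK.
Qed.

Lemma rV_dotP (a : A) u v w : rV_dot (a *: u + v) w = a * rV_dot u w + rV_dot v w.
Proof.
by rewrite /rV_dot mulr_sumr -big_split; apply: eq_bigr => i _; rewrite !mxE mulrDl mulrA.
Qed.

Lemma rV_dotC u v : rV_dot v u = CX_star (rV_dot u v).
Proof.
apply: CXP => x; rewrite [RHS](_ : _ = Num.conj (rV_dot u v x))//.
rewrite /rV_dot !CX_fun_sum rmorph_sum; apply: eq_bigr => i _.
rewrite [RHS](_ : _ = Num.conj (u 0 i x * Num.conj (v 0 i x)))//.
by rewrite rmorphM/= conjCK mulrC.
Qed.

Lemma rV_dot_ge0 u x : 0 <= rV_dot u u x.
Proof. by rewrite rV_dotE lecR; apply: sumr_ge0 => i _; rewrite sqr_ge0. Qed.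

Lemma normR_rV_le u i x : normR (u 0 i x) ^+ 2 <= normR (rV_dot u u x).
Proof.
rewrite rV_dotE normRC ger0_norm; last by apply: sumr_ge0 => j _; rewrite sqr_ge0.
by rewrite (bigD1 i)//= lerDl sumr_ge0// => j _; rewrite sqr_ge0.
Qed.

Lemma rV_dot_eq0 u : rV_dot u u = 0 -> u = 0.
Proof.
move=> u0; apply/rowP => i; rewrite mxE; apply: CXP => x; apply: normR0_eq0.
have := normR_rV_le u i x; rewrite u0 [X in _ <= normR X -> _](_ : _ = 0)//.
rewrite normR0 => h; apply/eqP; rewrite -sqrf_eq0.
by rewrite eq_le h sqr_ge0.
Qed.

(** Each coordinate is Cauchy in the complete space $C(X)$, and there are finitely many
    coordinates. *)
Lemma rV_complete (u : nat -> 'rV[A]_n) :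
  (forall eps : R, 0 < eps -> exists N, forall k m, (N <= k)%N -> (N <= m)%N ->
     Num.sqrt (normR (rV_dot (u k - u m) (u k - u m))) < eps) ->
  exists l, Num.sqrt (normR (rV_dot (u k - l) (u k - l))) @[k --> \oo] --> (0 : R).
Proof.
move=> uc.
have ui i : cvg ((fun k => u k 0 i) @ \oo).
  apply: cauchy_cvg; apply: cauchy_exP => eps e0.
  have er : (complex.Re eps)%:C%C = eps by rewrite RRe_real// gtr0_real.
  have {}e0 : 0 < complex.Re eps by rewrite -ltcR er.
  have e2 : 0 < complex.Re eps / 2 by rewrite divr_gt0.
  have [N NP] := uc _ e2.
  exists (u N 0 i); exists N => // k /= Nk; rewrite -ball_normE/= -er normRE ltcR.
  apply: (@le_lt_trans _ _ (complex.Re eps / 2)).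
    apply: CX_supnorm_le => [|x]; first exact: ltW.
    rewrite -(@ler_pXn2r _ 2) ?nnegrE ?normR_ge0 ?(ltW e2)//.
    have := normR_rV_le (u N - u k) i x; rewrite !mxE => /le_trans; apply.
    apply: le_trans (CX_le_supnorm _ x) _.
    rewrite -(sqr_sqrtr (CX_supnorm_ge0 _)) lerXn2r ?nnegrE ?sqrtr_ge0 ?(ltW e2)//.
    exact/ltW/NP.
  by rewrite gtr_pMr// invf_lt1// ltr1n.
exists (\row_i limn (fun k => u k 0 i)).
apply/cvgrPdist_lt => eps e0.
(* Chosen so that [n] times [d ^+ 2] is at most [(eps / 2) ^+ 2]; the successor covers [n = 0]. *)
pose d := eps / 2 / n.+1%:R; have d0 : 0 < d by rewrite !divr_gt0.
have : \forall k \near \oo, forall i, normR (limn (fun k => u k 0 i) - u k 0 i) < d.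
  by apply: filter_forall => i; have /normR_cvgP := ui i; exact.
apply: filterS => k kd; rewrite sub0r normrN ger0_norm ?sqrtr_ge0//.
apply: (@le_lt_trans _ _ (eps / 2)); last by rewrite gtr_pMr// invf_lt1// ltr1n.
have e2 : 0 <= eps / 2 by rewrite divr_ge0// ltW.
rewrite -(ger0_norm e2) -sqrtr_sqr ler_wsqrtr//.
apply: CX_supnorm_le => [|x]; first exact: sqr_ge0.
rewrite rV_dotE normRC ger0_norm; last by apply: sumr_ge0 => j _; rewrite sqr_ge0.
apply: (@le_trans _ _ (\sum_(i < n) d ^+ 2)).
  apply: ler_sum => i _; rewrite !mxE lerXn2r ?nnegrE ?normR_ge0 ?(ltW d0)//.
  rewrite -normRN (_ : - _ = (limn (fun k => u k 0 i) - u k 0 i) x); last first.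
    by rewrite -[in LHS]opprB opprK.
  exact: le_trans (CX_le_supnorm _ x) (ltW (kd i)).
rewrite sumr_const card_ord -[leLHS]mulr_natr /d expr_div_n -mulrA.
rewrite ler_piMr ?sqr_ge0// ler_pdivrMl ?exprn_gt0// mulr1 -natrX ler_nat.
by rewrite (leq_trans (leqnSn n))// leq_pmulr.
Qed.

HB.instance Definition _ := isHilbertModule.Build R X 'rV[A]_n
  rV_dotP rV_dotC rV_dot_ge0 rV_dot_eq0 rV_complete.

Lemma rV_fin_gen : alg_fin_gen 'rV[A]_n.
Proof.
exists n, (fun i => \row_j (i == j)%:R) => u; exists (u 0).
apply/rowP => j; rewrite summxE (bigD1 j)//= big1 ?addr0 => [|i ij].
  by rewrite !mxE eqxx mulr1.
by rewrite !mxE (negPf ij) mulr0.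
Qed.

End Free_module.

(** * The operator field of a C(X)-operator *)

Section DD_theory.
Context {R : realType} {H : hilbertType R} (e : orthonormal_basis H).
Context {X : compactHausdorffType}.
Local Notation A := (CX R X).
Local Notation l2A := (l2 R X).
Local Notation Q := (proj_perp e).

Lemma cvg_normR (V : normedModType R[i]) (T : Type) (F : set_system T)
    {FF : Filter F} (f : T -> V) (y : V) :
  f @ F --> y -> (normR (f t) @[t --> F] --> normR y).
Proof.
move=> /normR_cvgP fy; apply/cvgrPdist_lt => eps /fy; apply: filterS => t.
apply: le_lt_trans; rewrite ler_distl.
have := normR_le_add y (f t); have := normR_le_add (f t) y.
by rewrite (normR_distC (f t)); lra.
Qed.

Lemma cvg_realC (T : Type) (F : set_system T) {FF : Filter F} (r : T -> R) (l : R) :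
  r @ F --> l -> ((r t)%:C%C : R[i]^o) @[t --> F] --> (l%:C%C : R[i]^o).
Proof.
move=> /cvgrPdist_lt rl; apply/normR_cvgP => eps /rl; apply: filterS => t.
rewrite [X in normR X](_ : _ = (l - r t)%:C%C); last by rewrite rmorphB.
by rewrite [normR _]normRC.
Qed.

(** * Bump functions *)

Section Bump.
Variables (xi : l2A) (d : R) (d0 : 0 < d).

(** An explicit substitute for a Urysohn function: it is 1 where [xi] vanishes, and
    [h x * normR (l2_fun e xi x) <= d] everywhere. *)
Let h (x : X) : R := d / (d + normR (l2_fun e xi x)).

Let den_gt0 x : 0 < d + normR (l2_fun e xi x).
Proof. by rewrite ltr_pwDl ?normR_ge0. Qed.

Lemma bump_continuous : continuous (fun x => (h x)%:C%C : R[i]^o).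
Proof.
move=> x; apply: cvg_realC; apply: cvgM; first exact: cvg_cst.
apply: cvgV; first by rewrite gt_eqF.
apply: cvgD; first exact: cvg_cst.
by apply: cvg_normR; exact: l2_fun_continuous.
Qed.

Definition bump : A := mkCX bump_continuous.

Lemma l2_norm_bump : l2_norm (bump *: xi) <= d.
Proof.
apply/(l2_norm_leP e); first exact: ltW.
move=> x; rewrite l2_funZ normRZ [normR _](_ : _ = h x); last first.
  by rewrite [LHS]normRC ger0_norm// divr_ge0// ltW.
rewrite /h mulrAC ler_pdivrMr// ler_wpM2l ?(ltW d0)//.
by rewrite lerDr ltW.
Qed.

Lemma bumpE x : l2_fun e xi x = 0 -> bump x = 1.
Proof.
by move=> x0; rewrite [LHS](_ : _ = (h x)%:C%C)// /h x0 normR0 addr0 divff// gt_eqF.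
Qed.

End Bump.

Lemma l2_cstP_linear c a b :
  l2_cst e X (c *: a + b) = CX_cst X c *: l2_cst e X a + l2_cst e X b.
Proof.
by apply: (l2_fun_ext (e := e)) => x; rewrite l2_funD l2_funZ !l2_fun_cst.
Qed.

Variable K : {linear l2A -> l2A}.
Hypothesis Kb : bounded_op (@l2_norm R X) (@l2_norm R X) K.

Lemma DD_linear x : linear (DD e K x).
Proof.
by move=> c a b; rewrite /DD l2_cstP_linear linearP l2_funD l2_funZ.
Qed.

HB.instance Definition _ x :=
  GRing.isLinear.Build R[i] H H _ (DD e K x) (DD_linear x).

Lemma DD_continuous a : continuous (fun x => DD e K x a).
Proof. exact: l2_fun_continuous. Qed.

Lemma DD_bounded : exists2 C : R, 0 < C &
  forall x a, normR (DD e K x a) <= C * normR a.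
Proof.
have [C C0 KC] := bounded_op_gt0 (@l2_norm_ge0 R X) Kb.
exists C => // x a; apply: le_trans (normR_l2_fun_le _ _ _) _.
by rewrite (le_trans (KC _))// ler_wpM2l ?(ltW C0)// l2_norm_cst.
Qed.

(* By C(X)-linearity K multiplies with the bump function, which is 1 at x and
   makes the norm of an element vanishing at x arbitrarily small. *)
Lemma DD_local xi x : l2_fun e (K xi) x = DD e K x (l2_fun e xi x).
Proof.
have [C C0 KC] := bounded_op_gt0 (@l2_norm_ge0 R X) Kb.
pose eta := xi - l2_cst e X (l2_fun e xi x).
have eta0 : l2_fun e eta x = 0 by rewrite l2_funB l2_fun_cst subrr.
suff : l2_fun e (K eta) x = 0 by rewrite linearB/= l2_funB => /subr0_eq.
apply: normR0_eq0; apply/eqP; rewrite eq_le normR_ge0 andbT.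
apply/ler_addgt0Pr => eps e0; rewrite add0r.
have d0 : 0 < eps / C by rewrite divr_gt0.
have -> : l2_fun e (K eta) x = l2_fun e (K (bump eta d0 *: eta)) x.
  by rewrite linearZ/= l2_funZ bumpE// scale1r.
apply: le_trans (normR_l2_fun_le _ _ _) _.
rewrite (le_trans (KC _))// mulrC -ler_pdivlMr//; exact: l2_norm_bump.
Qed.

Definition uniform_tails := forall eps : R, 0 < eps ->
  exists N, forall x a, normR (Q N (DD e K x a)) <= eps * normR a.

(** * Truncation to finitely many coordinates *)

Section Truncation.
Variable n : nat.

(** Together with [extend_seq], this factors the truncation $(1-Q_n)K$ through $\mathcal A^n$, which
    makes it finitely generated. *)
Definition head_seq (xi : l2A) : 'rV[A]_n := \row_(k < n) K xi k.

Definition extend_fun (u : 'rV[A]_n) (k : nat) : A :=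
  if insub k is Some i then u 0 i else 0.

Lemma extend_funE u (i : 'I_n) : extend_fun u i = u 0 i.
Proof. by rewrite /extend_fun valK. Qed.

Lemma extend_fun0 u k : (n <= k)%N -> extend_fun u k = 0.
Proof. by move=> nk; rewrite /extend_fun insubN// -leqNgt. Qed.

Lemma extend_summable u : l2_summable (extend_fun u).
Proof.
apply/l2_summableP => eps e0.
exists ([set k | n <= k], [set k | n <= k])%N; first by split; exists n.
move=> [k m] /= [nk _] x; rewrite big_nat_cond big1 ?(ltW e0)// => i.
rewrite andbT => /andP[ki _]; rewrite extend_fun0 ?(leq_trans nk)//.
by rewrite [X in normR X](_ : _ = 0)// normR0 expr0n.
Qed.

Definition extend_seq u : l2A := MkL2 (@extend_summable u).

Lemma head_seq_linear : linear head_seq.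
Proof. by move=> f xi eta; apply/rowP => k; rewrite !mxE linearP. Qed.

Lemma extend_seq_linear : linear extend_seq.
Proof.
move=> f u v; apply: l2_eqP => k; rewrite [LHS]/= [RHS](_ : _ =
  f * extend_fun u k + extend_fun v k)//.
have [kn|nk] := ltnP k n; last by rewrite !extend_fun0// mulr0 addr0.
by rewrite -[k]/(val (Ordinal kn)) !extend_funE !mxE.
Qed.

HB.instance Definition _ :=
  GRing.isLinear.Build A l2A 'rV[A]_n _ head_seq head_seq_linear.
HB.instance Definition _ :=
  GRing.isLinear.Build A 'rV[A]_n l2A _ extend_seq extend_seq_linear.

Lemma sqr_normR_extend u x :
  normR (l2_fun e (extend_seq u) x) ^+ 2 = normR (hm_dot u u x).
Proof.
have Q0 : Q 0 (l2_fun e (extend_seq u) x) = l2_fun e (extend_seq u) x.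
  by rewrite /proj_perp big_ord0 subr0.
have Qn : Q n (l2_fun e (extend_seq u) x) = 0.
  apply: (onb_ext (e := e)) => k; rewrite hdot_proj_perp hdot0l hdot_l2_fun.
  by case: ltnP => // nk; rewrite [LHS](_ : _ = extend_fun u k x)// extend_fun0.
rewrite -Q0 (sqr_normR_proj_perp _ _ (leq0n n)) Qn normR0 expr0n addr0.
rewrite [in RHS](rV_dotE u x) normRC ger0_norm; last first.
  by apply: sumr_ge0 => i _; rewrite sqr_ge0.
rewrite big_mkord; apply: eq_bigr => i _; rewrite hdot_l2_fun.
by rewrite [X in normR X](_ : _ = extend_fun u i x)// extend_funE.
Qed.

Lemma l2_norm_extend u : l2_norm (extend_seq u) <= hm_norm u.
Proof.
apply/(l2_norm_leP e) => [|x]; first exact: sqrtr_ge0.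
rewrite -(@ler_pXn2r _ 2) ?nnegrE ?normR_ge0 ?sqrtr_ge0// sqr_normR_extend.
exact: ((hm_norm_leP u (sqrtr_ge0 _)).1 (lexx _)).
Qed.

Lemma l2_fun_head xi x : l2_fun e (extend_seq (head_seq xi)) x =
  l2_fun e (K xi) x - Q n (l2_fun e (K xi) x).
Proof.
apply: (onb_ext (e := e)) => k; rewrite hdotBl hdot_proj_perp !hdot_l2_fun.
rewrite [LHS](_ : _ = extend_fun (head_seq xi) k x)//.
have [kn|nk] := ltnP k n; last by rewrite extend_fun0// subrr.
by rewrite subr0 -[k]/(val (Ordinal kn)) extend_funE mxE.
Qed.

(** Extension by zero is isometric at each point, and $1-Q_n$ is a contraction by Pythagoras. *)
Lemma hm_norm_head xi : hm_norm (head_seq xi) <= l2_norm (K xi).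
Proof.
apply/hm_norm_leP => [|x]; first exact: l2_norm_ge0.
rewrite -sqr_normR_extend lerXn2r ?nnegrE ?normR_ge0 ?l2_norm_ge0//.
apply: le_trans (normR_l2_fun_le e (K xi) x).
rewrite l2_fun_head; set b := l2_fun _ _ _.
have orth : hdot (b - Q n b) (Q n b) = 0.
  by rewrite -hdot_proj_perpC linearB/= proj_perp_maxn maxnn subrr hdot0l.
have := sqr_normRD_orth orth; rewrite subrK => bE.
by rewrite -(@ler_pXn2r _ 2) ?nnegrE ?normR_ge0// bE lerDl sqr_ge0.
Qed.

End Truncation.

(** By [DD_local] the error of the truncation at [x] is $Q_NK_x(\xi(x))$, and $\|\xi(x)\|\le 1$ on
    the unit ball. *)
Lemma uniform_tails_compact : uniform_tails -> compact_Aop K.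
Proof.
move=> Kt; split=> // eps e0; have e2 : 0 < eps / 2 by rewrite divr_gt0.
have [N NP] := Kt _ e2.
exists (@extend_seq N \o head_seq N).
  exists ('rV[A]_N), (head_seq N), (extend_seq (n := N)).
  split=> //; first exact: rV_fin_gen.
    have [C KC] := Kb; exists C => xi; exact: le_trans (hm_norm_head _ _) (KC _).
  by exists 1 => u; rewrite mul1r l2_norm_extend.
apply: (@le_lt_trans _ _ (eps / 2)); last by rewrite gtr_pMr// invf_lt1// ltr1n.
apply: opnorm_le => [|xi xi1].
  exists 0; apply/(l2_norm_leP e) => // x.
  by rewrite l2_fun0 normR0.
apply/(l2_norm_leP e) => [|x]; first exact: ltW.
rewrite [X in l2_fun e X]/= l2_funB l2_fun_head subKr DD_local.
rewrite (le_trans (NP _ _))// ler_piMr ?(ltW e2)//.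
exact: le_trans (normR_l2_fun_le _ _ _) xi1.
Qed.

End DD_theory.

(** * Uniform boundedness on Hilbert modules *)

Section Hilbert_modules.
Context {R : realType} {X : compactHausdorffType} {M : hilbertModType R X}.
Local Notation A := (CX R X).
Implicit Types (u v w : M) (c : R[i]).
Local Notation N := (@hm_norm R X M).
Local Notation cst := (@CX_cst R X).

Lemma hm_dotDl u v w : hm_dot (u + v) w = hm_dot u w + hm_dot v w.
Proof. by rewrite -[u]scale1r hm_dotP mul1r scale1r. Qed.

Lemma hm_dot0l w : hm_dot 0 w = 0 :> A.
Proof. by have /eqP := hm_dotDl 0 0 w; rewrite addr0 addrC -subr_eq subrr => /eqP <-. Qed.

Lemma hm_dotNl u w : hm_dot (- u) w = - hm_dot u w.
Proof. by apply/eqP; rewrite -addr_eq0 -hm_dotDl addNr hm_dot0l. Qed.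

Lemma hm_dotDr u v w : hm_dot u (v + w) = hm_dot u v + hm_dot u w.
Proof.
rewrite (hm_dotC (v + w)) hm_dotDl (hm_dotC v u) (hm_dotC w u).
by apply: CXP => x; exact: rmorphD.
Qed.

Lemma hm_dotNr u w : hm_dot u (- w) = - hm_dot u w.
Proof.
rewrite (hm_dotC (- w)) hm_dotNl (hm_dotC w u).
by apply: CXP => x; exact: rmorphN.
Qed.

Lemma hm_norm_ge0 u : 0 <= N u. Proof. exact: sqrtr_ge0. Qed.

Lemma normR_hm_dot_le u x : normR (hm_dot u u x) <= N u ^+ 2.
Proof. exact: ((hm_norm_leP u (hm_norm_ge0 u)).1 (lexx _)). Qed.

(* The parallelogram law yields a triangle inequality up to a constant, which
   is all the completeness argument below needs. *)
Lemma hm_norm_quasi u v : N (u + v) <= 2 * N u + 2 * N v.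
Proof.
apply/hm_norm_leP => [|x]; first by rewrite addr_ge0// mulr_ge0// hm_norm_ge0.
have pE w : (normR (hm_dot w w x))%:C%C = hm_dot w w x.
  by rewrite -normRE ger0_norm// hm_dot_ge0.
have par : normR (hm_dot (u + v) (u + v) x) + normR (hm_dot (u - v) (u - v) x) =
    2 * normR (hm_dot u u x) + 2 * normR (hm_dot v v x).
  apply: complexI; rewrite !rmorphD !rmorphM/= !pE.
  have -> : (2%:C)%C = 2 :> R[i] by rewrite rmorph_nat.
  have : hm_dot (u + v) (u + v) + hm_dot (u - v) (u - v) =
      hm_dot u u + hm_dot u u + (hm_dot v v + hm_dot v v) :> A.
    by rewrite !(hm_dotDl, hm_dotNl, hm_dotDr, hm_dotNr); ring.
  move=> /(congr1 (fun f : A => f x)) h.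
  rewrite [LHS]h [LHS](_ : _ = hm_dot u u x + hm_dot u u x +
    (hm_dot v v x + hm_dot v v x))//; ring.
have := normR_hm_dot_le u x; have := normR_hm_dot_le v x.
have := normR_ge0 (hm_dot (u - v) (u - v) x).
have := hm_norm_ge0 u; have := hm_norm_ge0 v.
by nra.
Qed.

Lemma hm_normZ c u : N (cst c *: u) <= normR c * N u.
Proof.
apply/hm_norm_leP => [|x]; first by rewrite mulr_ge0 ?normR_ge0 ?hm_norm_ge0.
have -> : hm_dot (cst c *: u) (cst c *: u) x = c * Num.conj c * hm_dot u u x.
  have dZ v : hm_dot (cst c *: u) v = cst c * hm_dot u v :> A.
    by rewrite -[cst c *: u]addr0 hm_dotP hm_dot0l addr0.
  rewrite dZ (hm_dotC (cst c *: u)) dZ.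
  rewrite [LHS](_ : _ = c * Num.conj (c * hm_dot u u x))//.
  rewrite rmorphM/= mulrA; congr (_ * _).
  by rewrite conj_Creal// ger0_real// hm_dot_ge0.
rewrite normRM exprMn ler_pM ?normR_ge0//; last exact: normR_hm_dot_le.
by rewrite normRM expr2 ler_wpM2l ?normR_ge0// /normR norm_conjC.
Qed.

Lemma hm_normN u : N (- u) = N u.
Proof. by rewrite /hm_norm hm_dotNl hm_dotNr opprK. Qed.

(** Uniform boundedness is stated for seminorms because it is applied to the tail functionals of
    [tail_seminorm]. Complex scalars act on [M] through constant functions. *)
Record hm_seminorm := HmSeminorm {
  hm_semi :> M -> R;
  hm_semiD : forall u v, hm_semi (u + v) <= hm_semi u + hm_semi v;
  hm_semiZ : forall c u, hm_semi (cst c *: u) = normR c * hm_semi u;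
  hm_semi_bounded : exists C, forall u, hm_semi u <= C * N u
}.

Lemma hm_semi_unit (q : hm_seminorm) (C : R) :
  (forall u, N u <= 1 -> q u <= C) -> forall u, q u <= C * N u.
Proof.
move=> qC u; have [u0|u0] := eqVneq (N u) 0.
  (* Rescaling fails when [N u = 0]; boundedness of [q] then gives [q u <= 0]. *)
  by have [D /(_ u)] := hm_semi_bounded q; rewrite u0 !mulr0.
have {}u0 : 0 < N u by rewrite lt_neqAle eq_sym u0 hm_norm_ge0.
have nV : normR ((N u)^-1%:C%C : R[i]) = (N u)^-1.
  by rewrite normRC ger0_norm// invr_ge0 ltW.
have := qC (cst (N u)^-1%:C%C *: u); rewrite hm_semiZ nV mulrC ler_pdivrMr//.
by apply; rewrite (le_trans (hm_normZ _ _))// nV mulVf// gt_eqF.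
Qed.

Variables (I : Type) (q : I -> hm_seminorm).
Hypothesis q_bounded : forall u, exists C, forall i, q i u <= C.

Let q0 i : q i 0 = 0.
Proof. by rewrite -[0 in LHS](scaler0 _ (cst 0)) hm_semiZ normR0 mul0r. Qed.

Let qN i u : q i (- u) = q i u.
Proof.
rewrite -scaleN1r [X in X *: _](_ : _ = cst (-1)); last exact: CXP.
by rewrite hm_semiZ normRN normR1 mul1r.
Qed.

(** The ratio 32 absorbs the factors 2 of [hm_norm_quasi]: the limit [l] constructed below is within
    [13/2 * r k.+1] of [U k.+1], and four times this is below [r k]. *)
Let r (k : nat) : R := 32%:R ^- k.

Let r_gt0 k : 0 < r k.
Proof. by rewrite invr_gt0 exprn_gt0. Qed.

Let rS k : r k = 32%:R * r k.+1.
Proof. by rewrite /r exprS invfM mulrA divff ?mul1r// pnatr_eq0. Qed.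

(* Sokal's elementary proof of the uniform boundedness principle. *)
Lemma hm_banach_steinhaus : exists2 C : R, 0 < C & forall i u, q i u <= C * N u.
Proof.
have [[C qC]|nC] := pselect (exists C, forall i u, N u <= 1 -> q i u <= C).
  exists (`|C| + 1) => [|i u]; first by rewrite ltr_wpDl.
  by apply: hm_semi_unit => v /qC/le_trans; apply; rewrite ler_wpDr// ler_norm.
exfalso.
(* A move of length at most [r k] reaches a centre around which some [q i] is at least [k] on a ball
   of radius [r k / 4]. *)
have step (p : nat * M) : exists u, N (u - p.2) <= r p.1 /\ exists i,
    forall v, 4%:R * N (v - u) <= r p.1 -> p.1%:R <= q i v.
  case: p => k u /=.
  (* With [s] the norm of [q i], the inequality [C < s] will give [k%:R <= s * r k / 4]. *)
  pose C : R := 4%:R * k%:R / r k.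
  have [i [w0 [w01 qw0]]] : exists i, exists w, N w <= 1 /\ C < q i w.
    apply: contrapT => h; apply: nC; exists C => i w w1; rewrite leNgt.
    by apply/negP => Cq; apply: h; exists i, w.
  pose S := [set q i w | w in [set w | N w <= 1]].
  have supS : has_sup S.
    split; first by exists (q i w0), w0.
    have [D Dq] := hm_semi_bounded (q i); exists `|D| => _ [w w1 <-].
    rewrite (le_trans (Dq _))// (@le_trans _ _ (`|D| * N w))//.
      by rewrite ler_wpM2r ?hm_norm_ge0// ler_norm.
    by rewrite ler_piMr.
  pose s := sup S.
  have C0 : 0 <= C by rewrite divr_ge0 ?mulr_ge0// ltW.
  have Cs : C < s.
    by apply: lt_le_trans qw0 _; apply: ub_le_sup; [case: supS|exists w0].
  have s0 : 0 < s by apply: le_lt_trans Cs.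
  have qs v : q i v <= s * N v.
    apply: hm_semi_unit => w w1; apply: ub_le_sup; [by case: supS|by exists w].
  have s2 : 0 < s / 2 by rewrite divr_gt0.
  have [_ [w1 w11 <-]] := sup_adherent s2 supS.
  rewrite -/s => qw1.
  pose w := cst (r k)%:C%C *: w1.
  have nr : normR ((r k)%:C%C : R[i]) = r k by rewrite normRC ger0_norm// ltW.
  have Nw : N w <= r k.
    by rewrite (le_trans (hm_normZ _ _))// nr ler_piMr// ltW.
  have qw : r k * (s / 2) <= q i w.
    rewrite hm_semiZ nr ler_wpM2l ?(ltW (r_gt0 k))//.
    by rewrite [X in X - _]splitr addrK in qw1; exact: ltW.
  (* Since $q_i(2w)\le q_i(u+w)+q_i(u-w)$, one of $u\pm w$ has value at least [q i w]. *)
  have [u' [Nu' qu']] : exists u', N (u' - u) <= r k /\ q i w <= q i u'.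
    have [h|h] := leP (q i w) (q i (u + w)).
      by exists (u + w); split=> //; rewrite addrC addKr.
    exists (u - w); split; first by rewrite addrC addKr hm_normN.
    have : q i (w + w) <= q i (u + w) + q i (u - w).
      by rewrite -(qN i (u - w)) (le_trans _ (hm_semiD _ _ _))// opprB
        [u + w]addrC -addrA subrKC.
    rewrite [w + w](_ : _ = cst 2 *: w); last first.
      by rewrite [cst 2](_ : _ = 1 + 1) ?scalerDl ?scale1r//; exact: CXP.
    rewrite hm_semiZ (_ : normR _ = 2); first by move: h; lra.
    by rewrite -[2 in LHS](rmorph_nat (real_complex R)) normRC ger0_norm.
  exists u'; split=> //; exists i => v vu'.
  (* On the small ball the value drops by at most [s * r k / 4] from at least [s * r k / 2]. *)
  have : q i u' <= q i v + q i (v - u').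
    by rewrite -(qN i (v - u')) (le_trans _ (hm_semiD _ _ _))// opprB addrC subrK.
  have := qs (v - u').
  have : k%:R <= s * r k / 4%:R.
    by rewrite ler_pdivlMr// mulrC -ler_pdivrMr// ltW.
  by have := r_gt0 k; nra.
have [f fP] := choice step.
pose U := fix U k := if k is k'.+1 then f (k', U k') else 0.
have US k : N (U k.+1 - U k) <= r k by have [] := fP (k, U k).
have N0 : N 0 = 0.
  apply/eqP; rewrite eq_le hm_norm_ge0 andbT -(scaler0 _ (cst 0)).
  by rewrite (le_trans (hm_normZ _ _))// normR0 mul0r.
have Ud d k : N (U (d + k)%N - U k) <= 3%:R * r k.
  elim: d k => [|d IH] k; first by rewrite subrr N0 mulr_ge0// ltW.
  rewrite addSnnS -[_ - _](subrKA (U k.+1)) (le_trans (hm_norm_quasi _ _))//.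
  have := IH k.+1; have := US k; rewrite rS; have := r_gt0 k.+1; lra.
have r_cvg (eps : R) : 0 < eps -> exists K, forall k, (K <= k)%N -> r k < eps.
  move=> e0; have : (fun k => 32%:R^-1 ^+ k : R) @ \oo --> (0 : R).
    apply: cvg_expr; rewrite ger0_norm ?invr_ge0// invf_lt1// ltr1n//.
  move=> /cvgrPdist_lt/(_ _ e0)[K _ KP]; exists K => k /KP.
  by rewrite sub0r normrN ger0_norm ?exprn_ge0 ?invr_ge0// exprVn.
have [l Ul] : exists l, N (U n - l) @[n --> \oo] --> (0 : R).
  apply: hm_complete => eps e0.
  have /r_cvg[K KP] : 0 < eps / 20%:R by rewrite divr_gt0.
  exists K => m n Km Kn; rewrite -/(N _).
  have h k : (K <= k)%N -> N (U k - U K) <= 3%:R * r K.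
    by move=> /subnK <-; exact: Ud.
  rewrite -[U m - U n](subrKA (U K)).
  have := hm_norm_quasi (U m - U K) (U K - U n); have := h _ Km; have := h _ Kn.
  rewrite -(hm_normN (U K - U n)) opprB; have := KP _ (leqnn K); lra.
have [C Cq] := q_bounded l.
have [k Ck] : exists k : nat, C < k%:R.
  by exists (Num.bound `|C|); exact: le_lt_trans (ler_norm C) (archi_boundP (normr_ge0 C)).
have [_ [i /(_ l)]] := fP (k, U k); rewrite -/(U k.+1) /= => h.
(* The limit lies in the ball chosen at stage [k], so [q i l] is at least [k], against the bound [C]
   at [l]. *)
suff /h : 4%:R * N (l - U k.+1) <= r k by have := Cq i; lra.
have e0 : 0 < r k.+1 / 4%:R by rewrite divr_gt0.
have /cvgrPdist_lt/(_ _ e0)[K _ KP] := Ul.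
have := KP (K + k.+1)%N (leq_addr _ _).
rewrite sub0r normrN ger0_norm ?hm_norm_ge0// => hl.
have := hm_norm_quasi (l - U (K + k.+1)%N) (U (K + k.+1)%N - U k.+1).
rewrite subrKA -(hm_normN (l - U (K + _)%N)) opprB.
by have := Ud K k.+1; have := rS k; lra.
Qed.

End Hilbert_modules.

(** * Compact C(X)-operators have small tails *)

Section Fin_gen_tails.
Context {R : realType} {H : hilbertType R} (e : orthonormal_basis H).
Context {X : compactHausdorffType}.
Local Notation A := (CX R X).
Local Notation l2A := (l2 R X).
Local Notation Q := (proj_perp e).

Lemma linear_unit_ball (T : {linear H -> H}) (c : R) :
  (forall a, normR a <= 1 -> normR (T a) <= c) ->
  forall a, normR (T a) <= c * normR a.
Proof.
move=> Tc a; have [->|a0] := eqVneq a 0; first by rewrite linear0 !normR0 mulr0.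
have na0 : 0 < normR a.
  rewrite lt_neqAle normR_ge0 andbT eq_sym.
  by apply: contra a0 => /eqP/normR0_eq0 ->.
have nV : normR ((normR a)^-1%:C%C : R[i]) = (normR a)^-1.
  by rewrite normRC ger0_norm// invr_ge0 ltW.
have := Tc ((normR a)^-1%:C%C *: a); rewrite linearZ/= !normRZ nV mulVf ?gt_eqF//.
by move=> /(_ (lexx _)); rewrite mulrC ler_pdivrMr.
Qed.

Lemma tail_seminorm (M : hilbertModType R X) (T : {linear M -> l2A}) (c : R)
    (n : nat) x : 0 <= c -> bounded_op (@hm_norm R X M) (@l2_norm R X) T ->
  {q : @hm_seminorm R X M | forall u, q u = c * normR (Q n (l2_fun e (T u) x))}.
Proof.
move=> c0 Tb; pose f u := c * normR (Q n (l2_fun e (T u) x)).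
have fD u v : f (u + v) <= f u + f v.
  by rewrite /f !linearD/= l2_funD linearD -mulrDr ler_wpM2l// ler_normRD.
have fZ d u : f (CX_cst X d *: u) = normR d * f u.
  by rewrite /f linearZ/= l2_funZ linearZ/= normRZ mulrCA.
have fb : exists C, forall u, f u <= C * hm_norm u.
  have [C TC] := Tb; exists (c * C) => u; rewrite -mulrA ler_wpM2l//.
  apply: le_trans (normR_proj_perp _ _ _) _.
  exact: le_trans (normR_l2_fun_le _ _ _) (TC u).
by exists (HmSeminorm fD fZ fb).
Qed.

(* Every u in M is a combination of the generators g, so |Q_n (T u)| = O(max_i
   |Q_n (T (g i))|); the uniform boundedness principle makes the implied
   constant linear in the norm of u. *)
Lemma fin_gen_tails (F : {linear l2A -> l2A}) : fin_gen_Aop F ->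
  forall eps : R, 0 < eps ->
  exists n, forall xi x, normR (Q n (l2_fun e (F xi) x)) <= eps * l2_norm xi.
Proof.
move=> [M [P [T [[m [g gP]] Pb Tb FE]]]] eps e0.
have /choice[n nP] : forall k : nat, exists n, forall i x,
    normR (Q n (l2_fun e (T (g i)) x)) <= k.+1%:R^-1.
  move=> k; have k0 : 0 < k.+1%:R^-1 :> R by rewrite invr_gt0.
  have /choice[f fP] := fun i => l2_tail e (T (g i)) k0.
  by exists (\max_i f i) => i x; apply: fP; exact: leq_bigmax.
(* Weighting the tails at [n k] by [k.+1] keeps the family pointwise bounded: at $\sum_i c_ig_i$ by
   $\sum_i\|c_i\|$. A uniform constant then forces the tails down at rate $1/(k+1)$. *)
pose q (kx : nat * X) : hm_seminorm :=
  sval (tail_seminorm (n kx.1) kx.2 (ler0n R kx.1.+1) Tb).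
have qE k x u : q (k, x) u = k.+1%:R * normR (Q (n k) (l2_fun e (T u) x)).
  by rewrite /q; case: tail_seminorm.
have [C C0 Cq] : exists2 C : R, 0 < C & forall kx u, q kx u <= C * hm_norm u.
  apply: hm_banach_steinhaus => u; have [c ->] := gP u.
  exists (\sum_(i < m) CX_supnorm (c i)) => -[k x].
  rewrite qE linear_sum.
  have -> : l2_fun e (\sum_(i < m) T (c i *: g i)) x =
      \sum_(i < m) c i x *: l2_fun e (T (g i)) x.
    rewrite (big_morph (fun xi => l2_fun e xi x) (fun _ _ => l2_funD _ _ _ _) (l2_fun0 _ _)).
    by apply: eq_bigr => i _; rewrite linearZ/= l2_funZ.
  rewrite linear_sum -ler_pdivlMl// mulr_sumr.
  rewrite (le_trans (normR_sum _ _ _))//; apply: ler_sum => i _.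
  rewrite linearZ/= normRZ mulrC ler_pM ?normR_ge0//.
  exact: CX_le_supnorm.
have [D D0 PD] := bounded_op_gt0 (@l2_norm_ge0 R X) Pb.
pose k := Num.bound (C * D / eps).
have kP : C * D / eps < k.+1%:R.
  apply: lt_trans (archi_boundP _) _; last by rewrite ltr_nat.
  by rewrite divr_ge0 ?mulr_ge0// ltW.
exists (n k) => xi x; rewrite FE/=.
have := Cq (k, x) (P xi); rewrite qE -ler_pdivlMl// => /le_trans; apply.
rewrite ler_pdivrMl// (le_trans (ler_wpM2l (ltW C0) (PD xi)))//.
rewrite !mulrA ler_wpM2r ?l2_norm_ge0// ltW//.
by rewrite -ltr_pdivrMr.
Qed.

Variable K : {linear l2A -> l2A}.

Lemma compact_uniform_tails : compact_Aop K -> uniform_tails e K.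
Proof.
move=> [Kb Kc] eps e0; have e2 : 0 < eps / 2 by rewrite divr_gt0.
have [F Ffg KF] := Kc _ e2; have [n nP] := fin_gen_tails Ffg e2.
exists n => x; apply: (@linear_unit_ball (Q n \o DD e K x)) => a a1 /=.
have a1' : l2_norm (l2_cst e X a) <= 1 by apply: le_trans (l2_norm_cst _ _ _) a1.
(* Without boundedness [opnorm] could be 0 as the default value of [sup] and would control
   nothing. *)
have KFb : bounded_op (@l2_norm R X) (@l2_norm R X) (K \- F).
  have [C C0 KC] := bounded_op_gt0 (@l2_norm_ge0 R X) Kb.
  have [M [P [T [_ Pb Tb FE]]]] := Ffg.
  have [D D0 PD] := bounded_op_gt0 (@l2_norm_ge0 R X) Pb.
  have [E E0 TE] := bounded_op_gt0 (@hm_norm_ge0 R X M) Tb.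
  exists (C + E * D) => xi.
  apply/(l2_norm_leP e) => [|y]; first by rewrite mulr_ge0 ?l2_norm_ge0// addr_ge0 ?mulr_ge0// ltW.
  rewrite l2_funB (le_trans (ler_normRB _ _))// mulrDl lerD//.
    exact: le_trans (normR_l2_fun_le _ _ _) (KC xi).
  apply: le_trans (normR_l2_fun_le _ _ _) _; rewrite FE/= (le_trans (TE _))//.
  by rewrite -mulrA ler_wpM2l// ltW.
have -> : DD e K x a = l2_fun e ((K \- F) (l2_cst e X a)) x + l2_fun e (F (l2_cst e X a)) x.
  by rewrite l2_funB subrK.
rewrite linearD (splitr eps) (le_trans (ler_normRD _ _))// lerD//.
  apply: le_trans (normR_proj_perp _ _ _) _.
  apply: le_trans (normR_l2_fun_le _ _ _) _.
  exact: le_trans (le_opnorm (@l2_norm_ge0 R X) KFb a1') (ltW KF).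
by rewrite (le_trans (nP _ _))// ler_piMr// ltW.
Qed.

End Fin_gen_tails.

(** * Compactness in H through tails *)

Section Total_boundedness.
Context {R : realType} {H : hilbertType R} (e : orthonormal_basis H).
Local Notation Q := (proj_perp e).

Lemma ultra_bounded_limit (T : Type) (F : set_system T) (f : T -> R) (C : R) :
  UltraFilter F -> F [set t | `|f t| <= C] ->
  exists l : R, forall d : R, 0 < d -> F [set t | `|l - f t| < d].
Proof.
move=> FU FC; have Fs : F (f @^-1` `[- C, C]).
  by apply: filterS FC => t; rewrite /= ler_norml in_itv.
have [l [_ fl]] := @segment_compact R (- C) C (f @ F) _ Fs.
exists l => d d0.
(* An ultrafilter missing this set would contain its complement, against [l] being a cluster
   point. *)
have [//|nF] := in_ultra_setVsetC [set t | `|l - f t| < d] FU.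
have [r [/= lr rl]] := fl [set r | ~ `|l - r| < d] (ball l d) nF (nbhsx_ballx l d d0).
by [].
Qed.

(** Along an ultrafilter on [B] each coordinate converges, being bounded. As the tails are uniformly
    small, the ultrafilter is Cauchy, and [H] is complete. *)
Lemma closed_tails_compact (B : set H) (C : R) : closed B ->
  (forall b, B b -> normR b <= C) ->
  (forall eps : R, 0 < eps -> exists N, forall b, B b -> normR (Q N b) <= eps) ->
  compact B.
Proof.
move=> Bcl BC Bt; rewrite compact_ultra => F FU FB.
suff : cvg F.
  move=> /cvg_ex[p Fp]; exists p; split=> //; apply: Bcl => U /Fp FU'.
  exact: filter_ex (filterI FB FU').
apply: cauchy_cvg; apply: cauchy_exP => eps e0.
have er : (complex.Re eps)%:C%C = eps by rewrite RRe_real// gtr0_real.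
have {}e0 : 0 < complex.Re eps by rewrite -ltcR er.
move: (complex.Re eps) er e0 => {eps} d <- d0.
have d2 : 0 < d / 2 by rewrite divr_gt0.
have [N NB] := Bt _ d2.
have lim_comp (u : R[i] -> R) : (forall a, `|u a| <= normR a) -> forall k,
    exists l : R, forall d : R, 0 < d -> F [set b | `|l - u (hdot b (e k))| < d].
  move=> un k; apply: (@ultra_bounded_limit _ _ _ C FU).
  apply: filterS FB => b Bb /=; rewrite (le_trans (un _))//.
  rewrite (le_trans (normR_hdot_le _ _))// normR_onb mulr1.
  exact: BC.
have Ren (a : R[i]) : `|complex.Re a| <= normR a.
  by rewrite -lecR -normRE normc_ge_Re.
have Imn (a : R[i]) : `|complex.Im a| <= normR a.
  rewrite /normR normc_def/= -sqrtr_sqr ler_sqrt ?addr_ge0 ?sqr_ge0//.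
  by rewrite lerDr sqr_ge0.
have /choice[re reP] := lim_comp _ Ren.
have /choice[im imP] := lim_comp _ Imn.
pose c k : R[i] := (re k)%:C%C + (im k)%:C%C * 'i%C.
(* This centre depends on the radius [d] through [N], which [cauchy_exP] permits. *)
exists (\sum_(k < N) c k *: e k).
pose eta := d / 4%:R / N.+1%:R; have eta0 : 0 < eta by rewrite !divr_gt0.
have : F [set b | forall k : 'I_N, `|re k - complex.Re (hdot b (e k))| < eta /\
    `|im k - complex.Im (hdot b (e k))| < eta].
  apply: filter_forall => k; exact: filterI (reP k _ eta0) (imP k _ eta0).
move=> FP; near=> b; rewrite -ball_normE/= normRE ltcR.
have Bb : B b by near: b.
have bP : forall k : 'I_N, `|re k - complex.Re (hdot b (e k))| < eta /\
  `|im k - complex.Im (hdot b (e k))| < eta by near: b.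
have -> : \sum_(k < N) c k *: e k - b =
    \sum_(k < N) (c k - hdot b (e k)) *: e k - Q N b.
  rewrite /proj_perp opprB addrA; congr (_ - _).
  by rewrite -big_split/=; apply: eq_bigr => k _; rewrite -scalerDl subrK.
rewrite (splitr d) (le_lt_trans (ler_normRB _ _))// ltr_leD ?NB//.
rewrite (le_lt_trans (normR_sum _ _ _))//.
apply: (@le_lt_trans _ _ (\sum_(k < N) (eta + eta))).
  apply: ler_sum => k _; rewrite normRZ normR_onb mulr1.
  have -> : c k - hdot b (e k) = (re k - complex.Re (hdot b (e k)))%:C%C +
      (im k - complex.Im (hdot b (e k)))%:C%C * 'i%C.
    by rewrite /c; case: (hdot b (e k)) => x y; simpc.
  have ni : normR ('i%C : R[i]) = 1.
    by rewrite /normR normc_def/= expr0n/= add0r expr1n sqrtr1.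
  have [h1 h2] := bP k.
  rewrite (le_trans (ler_normRD _ _))// normRM ni mulr1 !normRC.
  by rewrite lerD// ltW.
rewrite sumr_const card_ord -[ltLHS]mulr_natr /eta.
rewrite (_ : _ + _ = d / 2 / N.+1%:R); last first.
  have N0 : (N.+1%:R : R) != 0 by rewrite pnatr_eq0.
  by field.
by rewrite -mulrA gtr_pMr// mulrC ltr_pdivrMr// mul1r ltr_nat.
Unshelve. all: by end_near. Qed.

(** The bounds pass to the closure up to a small error, so [closed_tails_compact] applies to it. *)
Lemma precompact_tails (A : set H) (C : R) :
  (forall b, A b -> normR b <= C) ->
  (forall eps : R, 0 < eps -> exists N, forall b, A b -> normR (Q N b) <= eps) ->
  precompact A.
Proof.
move=> AC At; rewrite precompactE.
have clA b (d : R) : 0 < d -> closure A b -> exists2 a, A a & normR (b - a) < d.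
  move=> d0 /(_ (ball b d%:C%C)) []; first by apply: nbhsx_ballx; rewrite ltcR.
  by move=> a [Aa]; rewrite -ball_normE/= normRE ltcR => h; exists a.
apply: (@closed_tails_compact _ (C + 1)); first exact: closed_closure.
  move=> b /(clA _ _ ltr01)[a Aa ba]; rewrite (le_trans (normR_le_add b a))//.
  by rewrite lerD ?AC// ltW.
move=> eps e0; have e2 : 0 < eps / 2 by rewrite divr_gt0.
have [N NA] := At _ e2; exists N => b /(clA _ _ e2)[a Aa ba].
rewrite (le_trans (normR_le_add _ (Q N a)))// (splitr eps) lerD ?NA//.
by rewrite -linearB/= (le_trans (normR_proj_perp _ _ _))// ltW.
Qed.

(** Near each [b] one threshold works, since $\|Q_mb'\|\le\|Q_mb\|+\|b'-b\|$; compactness in its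
    near-covering form makes the threshold uniform. *)
Lemma compact_op_tails (B : H -> H) (eps : R) : compact_op B -> 0 < eps ->
  exists N, forall n a, (N <= n)%N -> normR a <= 1 -> normR (Q n (B a)) <= eps.
Proof.
move=> [_]; rewrite precompactE => Bco e0.
have e2 : 0 < eps / 2 by rewrite divr_gt0.
have /compact_near_coveringP/(_ nat \oo
    (fun n b => forall m, (n <= m)%N -> normR (Q m b) <= eps)) := Bco.
move=> /(_ _)[] => [b _|N _ NB].
  have [N NP] := proj_perp_cvg0 e b e2.
  exists (ball b (eps / 2)%:C%C, [set n | (N <= n)%N]).
    by split; [apply: nbhsx_ballx; rewrite ltcR|exists N].
  move=> [b' n] [/=]; rewrite -ball_normE/= normRE ltcR => bb' Nn m nm.
  rewrite (le_trans (normR_le_add _ (Q m b)))// (splitr eps) lerD//.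
    by rewrite ltW// NP// (leq_trans Nn).
  by rewrite -linearB/= (le_trans (normR_proj_perp _ _ _))// normR_distC ltW.
exists N => n a Nn a1; apply: (NB N) => //=; apply: subset_closure.
by exists a => //=; rewrite normRE lecR.
Qed.

End Total_boundedness.

(** * The IM-topology *)

Section IM_subbase_topology.
Context {R : realType} {H : hilbertType R} (e : orthonormal_basis H).

Lemma IM_subbase_open (W : set (IMspace e)) : IM_subbase e W -> open W.
Proof.
move=> IW; exists [set W]; last by rewrite bigcup_set1.
by move=> _ ->; exact: (@finI_from1 _ _ (IM_subbase e) id).
Qed.

Lemma IM_continuous (X : topologicalType) (f : X -> IMspace e) :
  (forall W x, IM_subbase e W -> W (f x) -> \forall y \near x, W (f y)) ->
  continuous f.
Proof.
move=> fW x U; rewrite nbhsE => -[B [[D DI BE] Bfx] BU].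
move: Bfx; rewrite -BE => -[V DV Vfx].
suff : \forall y \near x, V (f y).
  by apply: filterS => y Vy; apply: BU; rewrite -BE; exists V.
have [E EI VE] := DI _ DV; rewrite -VE in Vfx *.
apply: filterS (@filter_bigI _ _ E (fun W => f @^-1` W) (nbhs x) _ _).
  by move=> y yE W; exact: yE.
move=> W WE; apply: fW; last exact: Vfx.
by have := EI _ WE; rewrite inE.
Qed.

End IM_subbase_topology.

(** * Invertible factors and their perturbation *)

Section IM_perturbation.
Context {R : realType} {H : hilbertType R} (e : orthonormal_basis H).
Local Notation Q := (proj_perp e).
Local Notation bounded := (bounded_op (@normR R H) (@normR R H)).

Lemma linear_pack (f : H -> H) : linear f ->
  exists g : {linear H -> H}, forall a, g a = f a.
Proof.
move=> lf.
pose g : {linear H -> H} := HB.pack f (GRing.isLinear.Build _ _ _ _ _ lf).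
by exists g.
Qed.

Lemma inGL1 : exists T : {linear H -> H}, inGL T /\ forall a, T a = a.
Proof.
have [T TE] := @linear_pack idfun (fun _ _ _ => erefl).
have Tb : bounded T by exists 1 => a; rewrite TE mul1r.
exists T; split=> //; split=> //; exists T.
by split=> // a; rewrite !TE.
Qed.

Lemma inGL_comp (S T : {linear H -> H}) : inGL S -> inGL T ->
  exists U : {linear H -> H}, inGL U /\ forall a, U a = S (T a).
Proof.
move=> [Sb [S' [S'b SK S'K]]] [Tb [T' [T'b TK T'K]]].
have comp_bounded (f g : H -> H) : bounded f -> bounded g -> bounded (f \o g).
  move=> /(bounded_op_gt0 (@normR_ge0 R H))[C C0 fC] [D gD]; exists (C * D) => a.
  by rewrite (le_trans (fC _))// -mulrA ler_wpM2l// ltW.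
exists (S \o T); split=> //; split; first exact: comp_bounded.
exists (T' \o S'); split; first exact: comp_bounded.
  by move=> a /=; rewrite SK TK.
by move=> a /=; rewrite T'K S'K.
Qed.

(** The inverse is $1-Z$, because $Z^2=0$. *)
Lemma inGL_square0 (Z : {linear H -> H}) : bounded Z -> (forall a, Z (Z a) = 0) ->
  exists T : {linear H -> H}, inGL T /\ forall a, T a = a + Z a.
Proof.
move=> [C ZC] ZZ.
have [T TE] : exists T : {linear H -> H}, forall a, T a = a + Z a.
  by apply: linear_pack => c a b; rewrite linearP scalerDr addrACA.
have [T' T'E] : exists T : {linear H -> H}, forall a, T a = a - Z a.
  by apply: linear_pack => c a b; rewrite linearP scalerBr opprD addrACA.
exists T; split=> //; split.
  exists (1 + C) => a; rewrite TE (le_trans (ler_normRD _ _))//.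
  by rewrite mulrDl mul1r lerD2l.
exists T'; split.
- exists (1 + C) => a; rewrite T'E (le_trans (ler_normRB _ _))//.
  by rewrite mulrDl mul1r lerD2l.
- by move=> a; rewrite T'E TE linearD ZZ addr0 addrK.
- by move=> a; rewrite TE T'E linearB ZZ subr0 subrK.
Qed.

(** Lets [le_opnorm] be applied to the maps in [IM_GLn]. *)
Lemma IM_diff_bounded (n : nat) (S T B B' : H -> H) :
  bounded S -> bounded T -> bounded B -> bounded B' ->
  bounded (fun a => T (S a + Q n (B a)) - (S a + Q n (B' a))).
Proof.
move=> [CS SC] /(bounded_op_gt0 (@normR_ge0 R H))[CT CT0 TC] [C BC] [C' BC'].
exists (CT * (CS + C) + (CS + C')) => b.
have sumC (A : H -> H) D : (forall a, normR (A a) <= D * normR a) ->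
    normR (S b + Q n (A b)) <= (CS + D) * normR b.
  move=> AD; rewrite (le_trans (ler_normRD _ _))// mulrDl lerD//.
  exact: le_trans (normR_proj_perp _ _ _) (AD _).
rewrite (le_trans (ler_normRB _ _))// mulrDl lerD ?sumC//.
by rewrite (le_trans (TC _))// -mulrA ler_wpM2l ?sumC// ltW.
Qed.

(* With E = Q_n P_N D and Z = E S^-1 Q_N, the operator 1 + Z is invertible as
   Z^2 = 0 (Q_N kills the range of E), and up to tails
   (1 + Z) (S + Q_n B) - (S + Q_n (B + D)) is - E S^-1 P_N S, which only involves
   the values of D on the finitely many vectors S^-1 e_k, k < N. *)
Lemma IM_perturb (n N : nat) (S T B D : {linear H -> H}) (C CS CT d eta : R) :
  0 <= C -> 0 <= CS -> 0 <= CT -> 0 <= d -> 0 <= eta ->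
  cancel T S -> cancel S T ->
  (forall a, normR (S a) <= CS * normR a) ->
  (forall a, normR (T a) <= CT * normR a) ->
  (forall a, normR (D a) <= C * normR a) ->
  (forall a, normR (Q N (B a)) <= d * normR a) ->
  (forall a, normR (Q N (D a)) <= d * normR a) ->
  (forall k, (k < N)%N -> normR (D (T (e k))) <= eta) ->
  exists2 U : {linear H -> H}, inGL U & forall a,
    normR (U (S a + Q n (B a)) - (S a + Q n (B a + D a))) <=
    (d + 2 * C * CT * d + N%:R * (CS * (2 * eta))) * normR a.
Proof.
move=> C0 CS0 CT0 d0 eta0 TK SK SC TC DC Bd Dd De.
have [P PE] : exists P : {linear H -> H}, forall a, P a = a - Q N a.
  by apply: linear_pack => c a b; rewrite linearP scalerBr opprD addrACA.
have P2 a : normR (P a) <= 2 * normR a.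
  rewrite PE (le_trans (ler_normRB _ _))// mulr_natl mulr2n lerD2l.
  exact: normR_proj_perp.
have [E EE] : exists E : {linear H -> H}, forall a, E a = Q n (P (D a)).
  by exists (Q n \o (P \o D)).
have E2 a : normR (E a) <= 2 * normR (D a).
  by rewrite EE (le_trans (normR_proj_perp _ _ _)).
have EC a : normR (E a) <= 2 * C * normR a.
  by rewrite (le_trans (E2 a))// -mulrA ler_wpM2l.
have QE a : Q N (E a) = 0.
  by rewrite EE PE proj_perp_maxn linearB/= proj_perp_maxn maxnAC maxnn subrr.
have [Z ZE] : exists Z : {linear H -> H}, forall a, Z a = E (T (Q N a)).
  by exists (E \o (T \o Q N)).
have [||U [UGL UE]] := @inGL_square0 Z.
- exists (2 * C * CT) => a; rewrite ZE (le_trans (EC _))// -[leRHS]mulrA ler_wpM2l ?mulr_ge0//.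
  by rewrite (le_trans (TC _))// ler_wpM2l// normR_proj_perp.
- by move=> a; rewrite !ZE QE !linear0.
exists U => // a.
have UwE : U (S a + Q n (B a)) = S a + Q n (B a) +
    (E (T (Q N (S a))) + E (T (Q N (Q n (B a))))).
  by rewrite UE ZE (linearD (Q N)) (linearD T) (linearD E).
(* As [T] inverts [S], $Ea=ET(Sa)$; splitting $Sa$ by $Q_N$ shows that $ZSa$ supplies $Q_nDa$ up to
   a tail and $ETPSa$. *)
have EPE : E (T (P (S a))) = Q n (D a) - Q n (Q N (D a)) - E (T (Q N (S a))).
  by rewrite (PE (S a)) (linearB T) (linearB E) SK (EE a) (PE (D a)) (linearB (Q n)).
have -> : U (S a + Q n (B a)) - (S a + Q n (B a + D a)) =
    - Q n (Q N (D a)) + E (T (Q N (Q n (B a)))) - E (T (P (S a))).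
  have cancel (s b c f x y : H) :
      s + b + (c + f) - (s + (b + x)) = - y + f - (x - y - c).
    rewrite [s + (b + x)]addrA [s + b + (c + f)]addrC addrKA !opprB [c + (_ - _)]addrCA.
    by rewrite addrACA addNr add0r addrCA addrA.
  by rewrite UwE EPE (linearD (Q n)); exact: cancel.
have h1 : normR (Q n (Q N (D a))) <= d * normR a.
  by rewrite (le_trans (normR_proj_perp _ _ _)).
have h2 : normR (E (T (Q N (Q n (B a))))) <= 2 * C * CT * d * normR a.
  rewrite (le_trans (EC _))// -!mulrA ler_wpM2l// ler_wpM2l//.
  rewrite (le_trans (TC _))// ler_wpM2l// proj_perp_maxn maxnC -proj_perp_maxn.
  by rewrite (le_trans (normR_proj_perp _ _ _)).
(* [P (S a)] is a combination of the [e k] with [k < N], and [E (T (e k))] has norm at most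
   [2 * eta]. *)
have h3 : normR (E (T (P (S a)))) <= N%:R * (CS * (2 * eta)) * normR a.
  rewrite PE /proj_perp opprB addrC subrK !linear_sum.
  rewrite (le_trans (normR_sum _ _ _))//.
  apply: (@le_trans _ _ (\sum_(k < N) CS * (2 * eta) * normR a)).
    apply: ler_sum => k _; rewrite !linearZ/= normRZ -mulrAC ler_pM ?normR_ge0//.
      rewrite (le_trans (normR_hdot_le _ _))// normR_onb mulr1.
      exact: SC.
    by rewrite (le_trans (E2 _))// ler_wpM2l// De.
  by rewrite sumr_const card_ord -[leLHS]mulr_natl mulrA.
rewrite (le_trans (ler_normRB _ _))// mulrDl lerD//.
by rewrite (le_trans (ler_normRD _ _))// mulrDl lerD// normRN.
Qed.

End IM_perturbation.

(** * IM-continuity from small tails *)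

Section Continuity.
Context {R : realType} {H : hilbertType R} (e : orthonormal_basis H).
Context {X : compactHausdorffType}.
Local Notation l2A := (l2 R X).
Local Notation Q := (proj_perp e).

Lemma compact_op_bounded (B : H -> H) : compact_op B ->
  bounded_op (@normR R H) (@normR R H) B.
Proof.
move=> [Bl]; rewrite precompactE => Bco.
have [T TE] := linear_pack Bl.
have /compact_near_coveringP/(_ nat \oo (fun n b => normR b <= n%:R)) := Bco.
move=> /(_ _)[] => [b _|N _ NB].
  exists (ball b (1 : R)%:C%C, [set n | (Num.bound (normR b + 1) <= n)%N]).
    by split; [apply: nbhsx_ballx; rewrite ltcR|exists (Num.bound (normR b + 1))].
  move=> [b' n] [/=]; rewrite -ball_normE/= normRE ltcR => bb' nb.
  rewrite (le_trans (normR_le_add _ b))// normR_distC.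
  have b10 : 0 <= normR b + 1 by rewrite addr_ge0 ?normR_ge0.
  have := archi_boundP b10; rewrite -(ler_nat R) in nb.
  by move: nb bb'; lra.
exists N%:R => a; rewrite -TE; apply: linear_unit_ball => b b1; rewrite TE.
apply: (NB N) => //=; apply: subset_closure.
by exists b => //=; rewrite normRE lecR.
Qed.

Variable K : {linear l2A -> l2A}.
Hypothesis Kb : bounded_op (@l2_norm R X) (@l2_norm R X) K.
Hypothesis Kt : uniform_tails e K.

Lemma DD_compact_op x : compact_op (DD e K x).
Proof.
split; first exact: DD_linear.
have [C C0 KC] := DD_bounded e Kb.
have u1 (u : H) : `|u| <= 1 -> normR u <= 1 by rewrite normRE lecR.
apply: (@precompact_tails _ _ e _ C) => [_ [a /u1 a1 <-]|eps e0].
  by rewrite (le_trans (KC _ _))// ler_piMr// ltW.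
have [N NP] := Kt e0; exists N => _ [a /u1 a1 <-].
by rewrite (le_trans (NP _ _))// ler_piMr// ltW.
Qed.

(** [IM_perturb] applies with [D] the difference $K_x-K_y$: its values at the finitely many
    [T (e k)], [k < N], are small for [y] near [x] by strong continuity. *)
Lemma DD_GL_near (S : {linear H -> H}) (n : nat) x (d : R) : inGL S -> 0 < d ->
  \forall y \near x, exists2 U : {linear H -> H}, inGL U & forall a,
    normR (U (S a + Q n (DD e K y a)) - (S a + Q n (DD e K x a))) <= d * normR a.
Proof.
move=> [Sb [T [Tb SK TK]]] d0.
have [C C0 KC] := DD_bounded e Kb.
have [CS CS0 SC] := bounded_op_gt0 (@normR_ge0 R H) Sb.
have [CT CT0 TC] := bounded_op_gt0 (@normR_ge0 R H) Tb.
(* Collects the coefficients of the tail bound in [IM_perturb], where [D] has norm at most [C + C].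
   The final halving in [t0] leaves room for the tail of a difference. *)
pose c := 1 + 2 * (C + C) * CT.
have c0 : 0 < c by rewrite addr_gt0// !mulr_gt0// addr_gt0.
have t0 : 0 < d / 2 / c / 2 by rewrite !divr_gt0.
have [N NP] := Kt t0.
(* Makes the term with [eta] at most [d / 2]; the added 1 covers [N = 0]. *)
pose eta := d / 2 / (N%:R * (CS * 2) + 1).
have den0 : 0 < N%:R * (CS * 2) + 1 by rewrite ltr_wpDl// !mulr_ge0// ltW.
have eta0 : 0 < eta by rewrite !divr_gt0.
have : \forall y \near x, forall k : 'I_N,
    normR (DD e K x (T (e k)) - DD e K y (T (e k))) < eta.
  apply: filter_forall => k.
  by have /normR_cvgP/(_ _ eta0) := @DD_continuous _ _ e _ K (T (e k)) x.
apply: filterS => y xy.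
have [D DE] : exists D : {linear H -> H}, forall a, D a = DD e K x a - DD e K y a.
  by apply: linear_pack => r a b; rewrite !DD_linear scalerBr opprD addrACA.
have [] := @IM_perturb _ _ e n N S T (DD e K y) D (C + C) CS CT (d / 2 / c) eta.
- by rewrite addr_ge0// ltW.
- exact: ltW.
- exact: ltW.
- by rewrite ltW// !divr_gt0.
- exact: ltW.
- exact: TK.
- exact: SK.
- exact: SC.
- exact: TC.
- by move=> a; rewrite DE (le_trans (ler_normRB _ _))// mulrDl lerD.
- move=> a; rewrite (le_trans (NP _ _))// ler_wpM2r ?normR_ge0//.
  by rewrite ler_piMr ?ltW ?divr_gt0// invf_lt1// ltr1n.
- move=> a; rewrite DE linearB (le_trans (ler_normRB _ _))//.
  by rewrite [d / 2 / c]splitr mulrDl lerD ?NP.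
- by move=> k kN; rewrite DE ltW// (xy (Ordinal kN)).
move=> U UGL UE; exists U => // a.
have -> : DD e K x a = DD e K y a + D a by rewrite DE addrC subrK.
rewrite (le_trans (UE a))// ler_wpM2r ?normR_ge0// [leRHS]splitr lerD//.
  rewrite (_ : _ + _ = d / 2 / c * c); first by rewrite divfK// gt_eqF.
  by rewrite /c; ring.
rewrite (_ : _ * _ = d / 2 * ((N%:R * (CS * 2)) / (N%:R * (CS * 2) + 1))).
  by rewrite ler_piMr ?ltW ?divr_gt0// ltr_pdivrMr// mul1r ltrDl.
by rewrite /eta; field; rewrite gt_eqF.
Qed.

Lemma DD_IM_continuous :
  continuous (fun x => CompactOp (DD_compact_op x) : IMspace e).
Proof.
have [C C0 KC] := DD_bounded e Kb.
apply: IM_continuous => W x [[eps [s [K0 [e0 ->]]]]|[eps [S [K0 [e0 SGL ->]]]]].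
  move=> xW; have : \forall y \near x, forall i : 'I_(size s),
      normR (DD e K y (s`_i) - K0 s`_i) < eps.
    apply: filter_forall => i; have := xW s`_i (mem_nth _ (ltn_ord i)).
    rewrite -subr_gt0 => d0.
    have /normR_cvgP/(_ _ d0) := @DD_continuous _ _ e _ K s`_i x.
    apply: filterS => y; rewrite ltrBrDr; apply: le_lt_trans.
    rewrite -[X in normR X](subrKA (DD e K x s`_i)) (le_trans (ler_normRD _ _))//.
    by rewrite normR_distC.
  apply: filterS => y sy a /= /(nthP 0)[i si <-].
  exact: (sy (Ordinal si)).
(* The centre [K0] need not be $K_x$. For large [n] the identity serves as invertible factor, both
   tails being at most [eps / 3]; only finitely many [n] remain. *)
move=> xW; have e3 : 0 < eps / 3%:R by rewrite divr_gt0.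
have [N1 N1P] := Kt e3; have [N2 N2P] := compact_op_tails e (copP K0) e3.
have : \forall y \near x, forall n : 'I_(maxn N1 N2),
    IM_GLn e eps n S K0 (CompactOp (DD_compact_op y)).
  apply: filter_forall => n; have [T TGL Tx] := xW n I.
  have [CT CT0 TC] := bounded_op_gt0 (@normR_ge0 R H) TGL.1.
  move: Tx; rewrite -subr_gt0; set t := opnorm _ _ _ => t0.
  (* Spends half of the slack in the strict inequality at [x]: applying [T] multiplies the error by
     at most [CT]. *)
  have d0 : 0 < (eps - t) / 2 / CT by rewrite !divr_gt0.
  apply: filterS (DD_GL_near n x SGL d0) => y [U UGL Uy].
  have [V [VGL VE]] := inGL_comp TGL UGL; exists V => //.
  apply: (@le_lt_trans _ _ ((eps - t) / 2 + t)); last by move: t0; lra.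
  apply: opnorm_le => [|a a1]; first by exists 0; rewrite normR0.
  rewrite VE -[X in normR X](subrKA (T (S a + Q n (DD e K x a)))).
  rewrite (le_trans (ler_normRD _ _))// lerD//.
    rewrite -linearB (le_trans (TC _))// -ler_pdivlMl// mulrC.
    by rewrite (le_trans (Uy _))// ler_piMr// ltW.
  apply: (le_opnorm (@normR_ge0 R H) _ a1).
  apply: IM_diff_bounded; [exact: SGL.1|exact: TGL.1|exists C; exact: KC|].
  exact: compact_op_bounded (copP K0).
apply: filterS => y yW n _.
have [nN|] := ltnP n (maxn N1 N2); first exact: (yW (Ordinal nN)).
rewrite geq_max => /andP[N1n N2n].
have [T [TGL TE]] := @inGL1 R H; exists T => //.
apply: (@le_lt_trans _ _ (eps / 3%:R + eps / 3%:R)); last by move: e0; lra.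
apply: opnorm_le => [|a a1]; first by exists 0; rewrite normR0.
rewrite TE opprD addrACA subrr add0r (le_trans (ler_normRB _ _))// lerD//.
  rewrite (le_trans (normR_proj_perp_le _ _ N1n))// (le_trans (N1P _ _))//.
  by rewrite ler_piMr// ltW.
exact: N2P.
Qed.

End Continuity.

(** * Operators given by series *)

Section Series_operators.
Context {R : realType} {H : hilbertType R}.
Local Notation bounded := (bounded_op (@normR R H) (@normR R H)).

Lemma sum_half_powers m n : (m <= n)%N ->
  \sum_(m <= k < n) 2%:R ^- k = 2 * 2%:R ^- m - 2 * 2%:R ^- n :> R.
Proof.
elim: n => [|n IH]; first by rewrite leqn0 => /eqP ->; rewrite big_geq// subrr.
rewrite leq_eqVlt => /predU1P[->|mn]; first by rewrite big_geq// subrr.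
have h : 2%:R ^- n = 2 * 2%:R ^- n.+1 :> R.
  by rewrite exprS invfM mulrA divff ?mul1r// pnatr_eq0.
by rewrite big_nat_recr//= IH// h; ring.
Qed.

Lemma half_powers_cvg0 (c eps : R) : 0 < eps ->
  exists N, forall k, (N <= k)%N -> c * 2%:R ^- k < eps.
Proof.
move=> e0; have c1 : 0 < `|c| + 1 by rewrite ltr_wpDl.
have d0 : 0 < eps / (`|c| + 1) by rewrite divr_gt0.
have : (fun k => 2%:R^-1 ^+ k : R) @ \oo --> (0 : R).
  by apply: cvg_expr; rewrite ger0_norm ?invr_ge0// invf_lt1// ltr1n.
move=> /cvgrPdist_lt/(_ _ d0)[K _ KP]; exists K => k /KP.
rewrite sub0r normrN ger0_norm ?exprn_ge0 ?invr_ge0// exprVn ltr_pdivlMr// mulrC.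
apply: le_lt_trans; rewrite ler_wpM2r ?invr_ge0 ?exprn_ge0//.
by rewrite ler_wpDr// ler_norm.
Qed.

Lemma half_series (f : nat -> H) (c : R) : 0 <= c ->
  (forall k, normR (f k) <= c * 2%:R ^- k) ->
  cvgn (series f) /\ normR (limn (series f)) <= 2 * c.
Proof.
move=> c0 fc.
have sum_le m n : (m <= n)%N -> normR (\sum_(m <= k < n) f k) <= 2 * c * 2%:R ^- m.
  move=> mn; rewrite (le_trans (normR_sum _ _ _))//.
  rewrite (le_trans (ler_sum _ (fun k _ => fc k)))// -mulr_sumr sum_half_powers//.
  by rewrite mulrBr mulrCA mulrA gerBl mulr_ge0// mulr_ge0// invr_ge0 exprn_ge0.
have fcv : cvgn (series f).
  apply: cvg_series_normR => eps e0; have [N NP] := half_powers_cvg0 (2 * c) e0.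
  exists N => m n /andP[Nm mn]; exact: le_lt_trans (sum_le _ _ mn) (NP _ Nm).
split=> //; apply: (cvg_normR_le fcv); near=> n.
by have := sum_le 0 n (leq0n n); rewrite expr0 invr1 mulr1.
Unshelve. all: by end_near. Qed.

Lemma bounded_linear_cvg (L : {linear H -> H}) (u : nat -> H) (l : H) : bounded L ->
  u @ \oo --> l -> (L (u n) @[n --> \oo] --> L l).
Proof.
move=> /(bounded_op_gt0 (@normR_ge0 R H))[C C0 LC] /normR_cvgP ul.
apply/normR_cvgP => eps e0; have /ul : 0 < eps / C by rewrite divr_gt0.
apply: filterS => n; rewrite ltr_pdivlMr// mulrC -linearB; exact: le_lt_trans.
Qed.

Lemma cvg_unique_seq (u : nat -> H) (a b : H) :
  u @ \oo --> a -> u @ \oo --> b -> a = b.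
Proof.
by move=> /(cvg_lim (@norm_hausdorff _ _)) <- /(cvg_lim (@norm_hausdorff _ _)) <-.
Qed.

(** The estimate $\|a\|\le 2\|Ta\|$ gives injectivity and bounds the inverse; the Neumann series
    $\sum_kL^kb$ gives surjectivity. *)
Lemma inGL_neumann (L : {linear H -> H}) :
  (forall a, normR (L a) <= 2^-1 * normR a) ->
  exists T : {linear H -> H}, inGL T /\ forall a, T a = a - L a.
Proof.
move=> L2; have Lb : bounded L by exists 2^-1.
have [T TE] : exists T : {linear H -> H}, forall a, T a = a - L a.
  by apply: linear_pack => c a b; rewrite linearP scalerBr opprD addrACA.
have TN a : normR a <= 2 * normR (T a).
  by have := normR_le_add a (L a); have := L2 a; rewrite TE; lra.
have Tinj a b : T a = T b -> a = b.
  move=> ab; apply/eqP; rewrite -subr_eq0; apply/eqP/normR0_eq0/eqP.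
  by rewrite eq_le normR_ge0 (le_trans (TN _))// linearB ab subrr normR0 mulr0.
have Tsurj b : exists a, T a = b.
  pose f k := iter k L b.
  have [fcv _] : cvgn (series f) /\ normR (limn (series f)) <= 2 * normR b.
    apply: half_series => [|k]; first exact: normR_ge0.
    elim: k => [|k IH]; first by rewrite expr0 invr1 mulr1.
    rewrite [f k.+1]/= (le_trans (L2 _))// exprS invfM mulrCA.
    by rewrite ler_wpM2l// invr_ge0.
  exists (limn (series f)); rewrite TE.
  (* The limit of $s_{n+1}=b+Ls_n$ shows that the sum $s$ solves $s-Ls=b$. *)
  have h1 : (fun n => series f n.+1) @ \oo --> limn (series f).
    by rewrite (@cvg_shiftS _ (series f)).
  have h2 : (fun n => b + L (series f n)) @ \oo --> b + L (limn (series f)).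
    by apply: cvgD; [exact: cvg_cst|exact: bounded_linear_cvg].
  have hE : (fun n => series f n.+1) = (fun n => b + L (series f n)).
    apply/funext => n; rewrite /series/= big_nat_recl// linear_sum; congr (_ + _).
  by rewrite hE in h1; rewrite {1}(cvg_unique_seq h1 h2) addrK.
have [T' TT'] := choice Tsurj.
have T'K a : T' (T a) = a by apply: Tinj.
have [U UE] : exists U : {linear H -> H}, forall a, U a = T' a.
  by apply: linear_pack => c a b; apply: Tinj; rewrite linearP !TT'.
exists T; split=> //; split.
  exists (1 + 2^-1) => a; rewrite TE (le_trans (ler_normRB _ _))//.
  by rewrite mulrDl mul1r lerD2l.
exists U; split=> [|a|a]; rewrite ?UE//.
by exists 2 => a; rewrite UE (le_trans (TN _))// TT'.
Qed.

Variable u : nat -> H.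
Hypothesis uE : forall i j, hdot (u i) (u j) = (i == j)%:R.

(** Bessel's inequality for an orthonormal sequence that need not be complete: [s] is the projection
    of [a] on the span of the first [n] vectors. *)
Lemma bessel_orthonormal n a :
  \sum_(0 <= k < n) normR (hdot a (u k)) ^+ 2 <= normR a ^+ 2.
Proof.
pose f k := hdot a (u k) *: u k; pose s := \sum_(0 <= k < n) f k.
have nu k : normR (u k) = 1.
  apply/eqP; rewrite -(@eqrXn2 _ 2) ?normR_ge0// expr1n; apply/eqP/complexI.
  by rewrite sqr_normRE uE eqxx.
have fo i j : i != j -> hdot (f i) (f j) = 0.
  by move=> /negPf ij; rewrite hdotZl hdotZr uE ij !mulr0.
have sE : normR s ^+ 2 = \sum_(0 <= k < n) normR (hdot a (u k)) ^+ 2.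
  by rewrite sqr_normR_sum_orth//; under eq_bigr do rewrite normRZ nu mulr1.
have su k : (k < n)%N -> hdot s (u k) = hdot a (u k).
  move=> kn; rewrite hdot_suml big_mkord (bigD1 (Ordinal kn))//= big1 => [|i ik].
    by rewrite addr0 hdotZl uE eqxx mulr1.
  by rewrite hdotZl uE; move: ik; rewrite -val_eqE/= => /negPf ->; rewrite mulr0.
have so : hdot (a - s) s = 0.
  apply: hdot_eq0C; rewrite {1}/s hdot_suml big_nat_cond big1// => k.
  rewrite andbT => /andP[_ kn]; rewrite hdotZl [hdot (u k) _]hdot_eq0C ?mulr0//.
  by rewrite hdotBl su// subrr.
by rewrite -sE; have := sqr_normRD_orth so; rewrite subrK => ->; rewrite lerDr sqr_ge0.
Qed.

Lemma normR_hdot_orthonormal a k : normR (hdot a (u k)) <= normR a.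
Proof.
rewrite (le_trans (normR_hdot_le _ _))// -[leRHS]mulr1 ler_wpM2l ?normR_ge0//.
rewrite -(@ler_pXn2r _ 2) ?nnegrE ?normR_ge0// expr1n -lecR sqr_normRE uE eqxx.
by rewrite lexx.
Qed.

Let partial (z : nat -> H) a := series (fun j => hdot a (u j) *: z j).

Lemma sum_operator (z : nat -> H) (C : R) :
  (forall a, cvgn (partial z a) /\ normR (limn (partial z a)) <= C * normR a) ->
  exists G : {linear H -> H}, [/\ forall a, normR (G a) <= C * normR a,
    forall a, partial z a @ \oo --> G a & forall i, G (u i) = z i].
Proof.
move=> zC; have zcv a : partial z a @ \oo --> limn (partial z a) by have [] := zC a.
have [G GE] : exists G : {linear H -> H}, forall a, G a = limn (partial z a).
  apply: linear_pack => c a b; apply: cvg_unique_seq (zcv _) _.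
  have -> : partial z (c *: a + b) = fun n => c *: partial z a n + partial z b n.
    apply/funext => n; rewrite /partial /series/= scaler_sumr -big_split/=.
    by apply: eq_bigr => j _; rewrite hdotDl hdotZl scalerDl scalerA.
  by apply: cvgD; [apply: cvgZr; exact: zcv|exact: zcv].
exists G; split=> [a|a|i]; rewrite GE; [by have [] := zC a|exact: zcv|].
apply: cvg_unique_seq (zcv _) _; apply: cvg_near_cst; near=> n.
have ni : (i < n)%N by near: n; exists i.+1.
rewrite /partial /series/= big_mkord (bigD1 (Ordinal ni))//= big1 => [|j ij].
  by rewrite uE eqxx scale1r addr0.
by rewrite uE eq_sym; move: ij; rewrite -val_eqE/= => /negPf ->; rewrite scale0r.
Unshelve. all: by end_near. Qed.

Lemma orth_operator (z : nat -> H) (D : R) : 0 <= D ->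
  (forall i j, i != j -> hdot (z i) (z j) = 0) ->
  (forall j, normR (z j) <= D) ->
  exists G : {linear H -> H}, [/\ forall a, normR (G a) <= D * normR a,
    forall a, partial z a @ \oo --> G a & forall i, G (u i) = z i].
Proof.
move=> D0 zo zD; apply: sum_operator => a.
have fo i j : i != j -> hdot (hdot a (u i) *: z i) (hdot a (u j) *: z j) = 0.
  by move=> /zo ij; rewrite hdotZl hdotZr ij !mulr0.
have fD n : \sum_(0 <= k < n) normR (hdot a (u k) *: z k) ^+ 2 <= (D * normR a) ^+ 2.
  apply: (@le_trans _ _ (\sum_(0 <= k < n) normR (hdot a (u k)) ^+ 2 * D ^+ 2)).
    apply: ler_sum => k _; rewrite normRZ exprMn ler_wpM2l ?sqr_ge0//.
    by rewrite lerXn2r ?nnegrE ?normR_ge0.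
  by rewrite -mulr_suml exprMn mulrC ler_wpM2l ?sqr_ge0// bessel_orthonormal.
split; first exact: orth_series_cvg fo fD.
by apply: orth_series_le; rewrite ?mulr_ge0 ?normR_ge0.
Qed.

Lemma summable_operator (t : nat -> H) (c : R) : 0 <= c ->
  (forall j, normR (t j) <= c * 2%:R ^- j) ->
  exists G : {linear H -> H}, [/\ forall a, normR (G a) <= 2 * c * normR a,
    forall a, partial t a @ \oo --> G a & forall i, G (u i) = t i].
Proof.
move=> c0 tc; apply: sum_operator => a; rewrite -mulrA.
apply: half_series => [|k]; first by rewrite mulr_ge0 ?normR_ge0.
by rewrite normRZ mulrC mulrAC ler_pM ?normR_ge0// normR_hdot_orthonormal.
Qed.

(** With $G=\sum_j\langle\cdot,u_j\rangle z_j$ and $F$ likewise for $w$, $(1-G)(1-F)=1$ means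
    $GF=G+F$. Since $\langle w_i,u_j\rangle=0$ for $i\ne j$, $GFa=\sum_j\langle a,u_j\rangle\langle
    w_j,u_j\rangle z_j$, and the relation between [z] and [w] concludes. *)
Lemma orth_operator_inv (z w : nat -> H) (G F : {linear H -> H}) :
  bounded G ->
  (forall i j, i != j -> hdot (w i) (u j) = 0) ->
  (forall j, z j + w j = hdot (w j) (u j) *: z j) ->
  (forall a, partial z a @ \oo --> G a) ->
  (forall a, partial w a @ \oo --> F a) ->
  forall a, (a - F a) - G (a - F a) = a.
Proof.
move=> Gb wu zw Gz Fw a.
have Fu j : hdot (F a) (u j) = hdot a (u j) * hdot (w j) (u j).
  apply: (cvg_hdot (Fw a)); near=> n.
  have jn : (j < n)%N by near: n; exists j.+1.
  rewrite /partial /series/= hdot_suml big_mkord (bigD1 (Ordinal jn))//= big1 => [|i ij].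
    by rewrite addr0 hdotZl.
  by rewrite hdotZl wu ?mulr0//; move: ij; rewrite -val_eqE.
have GF : G (F a) = G a + F a.
  apply: cvg_unique_seq (Gz (F a)) _.
  have -> : partial z (F a) = fun n => partial z a n + partial w a n.
    apply/funext => n; rewrite /partial /series/= -big_split/=.
    by apply: eq_bigr => j _; rewrite Fu -scalerA -zw scalerDr.
  by apply: cvgD.
by rewrite linearB GF opprB [G a + F a]addrC addrK subrK.
Unshelve. all: by end_near. Qed.

End Series_operators.

(** * An invertible operator with prescribed values *)

Section Block_operator.
Context {R : realType} {H : hilbertType R} (e : orthonormal_basis H).
Local Notation Q := (proj_perp e).
Variables (p : nat -> nat) (u v : nat -> H) (C kappa theta : R).
Hypothesis p_le : forall j, (p j <= p j.+1)%N.
Hypothesis uP : forall j, Q (p j) (u j) = u j.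
Hypothesis uQ : forall j, Q (p j.+1) (u j) = 0.
Hypothesis u1 : forall j, normR (u j) = 1.
Hypothesis vP : forall j, Q (p j) (v j) = v j.
Hypothesis vC : forall j, normR (v j) <= C.
Hypothesis kappa_gt0 : 0 < kappa.
Hypothesis v_kappa : forall j, kappa <= normR (hdot (v j) (u j)).
Hypothesis theta_ge0 : 0 <= theta.
Hypothesis vQ : forall j, normR (Q (p j.+1) (v j)) <= theta * 2%:R ^- j.
Hypothesis theta_small : (1 + (2 * C + 1) / kappa) * (2 * theta) <= 2^-1.

(** The vectors live in disjoint coordinate blocks, from [p k] up to but excluding [p k.+1]. *)
Let block_orth (a b : nat -> H) i j :
  (forall k, Q (p k) (a k) = a k /\ Q (p k.+1) (a k) = 0) ->
  (forall k, Q (p k) (b k) = b k /\ Q (p k.+1) (b k) = 0) ->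
  i != j -> hdot (a i) (b j) = 0.
Proof.
have p_mono k l : (k <= l)%N -> (p k <= p l)%N.
  move=> /subnK <-; elim: (l - k)%N => // n IH.
  exact: leq_trans IH (p_le _).
have wlog_lt (f g : nat -> H) k l :
    (forall k, Q (p k) (f k) = f k /\ Q (p k.+1) (f k) = 0) ->
    (forall k, Q (p k) (g k) = g k /\ Q (p k.+1) (g k) = 0) ->
    (k < l)%N -> hdot (f k) (g l) = 0.
  move=> fP gP /p_mono kl; have [gl _] := gP l; have [_ fk] := fP k.
  by rewrite -gl -hdot_proj_perpC -(maxn_idPl kl) -proj_perp_maxn fk linear0 hdot0l.
move=> aP bP; rewrite neq_ltn => /orP[ij|ji]; first exact: wlog_lt.
by apply: hdot_eq0C; exact: wlog_lt.
Qed.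

(* S acts on the span of the u_j by u_j |-> - z_j - t_j + u_j, where the z_j lie
   in mutually orthogonal blocks and the t_j are summably small: the block part
   is inverted explicitly and the t_j are absorbed by a Neumann series. *)
Lemma block_GL : exists S : {linear H -> H}, inGL S /\ forall j, S (u j) = - v j.
Proof.
have uB k : Q (p k) (u k) = u k /\ Q (p k.+1) (u k) = 0 by split.
have uE i j : hdot (u i) (u j) = (i == j)%:R.
  have [->|ij] := eqVneq i j; last exact: (block_orth uB uB).
  by rewrite -sqr_normRE u1 expr1n.
pose c j := hdot (v j) (u j); pose t j := Q (p j.+1) (v j).
have c0 j : c j != 0.
  apply: contraTneq (v_kappa j) => cj; rewrite -/(c j) cj normR0 -ltNge.
  exact: kappa_gt0.
(* The operator $1-\langle\cdot,u_j\rangle z_j$ is a rank-one perturbation of the identity with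
   $\langle z_j,u_j\rangle=c_j+1$; [w j] is read off from its inverse $1-\langle\cdot,u_j\rangle
   w_j$. *)
pose z j := v j - t j + u j; pose w j := (c j)^-1 *: z j.
have pE j : maxn (p j) (p j.+1) = p j.+1 by apply/maxn_idPr.
have zB k : Q (p k) (z k) = z k /\ Q (p k.+1) (z k) = 0.
  split; rewrite /z linearD linearB/= proj_perp_maxn.
    by rewrite uP vP pE.
  by rewrite uQ maxnn subrr addr0.
have wB k : Q (p k) (w k) = w k /\ Q (p k.+1) (w k) = 0.
  by have [h1 h2] := zB k; split; rewrite linearZ/= ?h1 ?h2 ?scaler0.
have zu j : hdot (z j) (u j) = c j + 1.
  by rewrite hdotDl hdotBl hdot_proj_perpC uQ hdot0r subr0 uE eqxx.
have C0 : 0 <= C := le_trans (normR_ge0 (v 0%N)) (vC 0).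
have D0 : 0 <= 2 * C + 1 by rewrite addr_ge0// mulr_ge0.
have zD j : normR (z j) <= 2 * C + 1.
  rewrite (le_trans (ler_normRD _ _))// u1 lerD2r (le_trans (ler_normRB _ _))//.
  by rewrite mulr_natl mulr2n lerD// (le_trans (normR_proj_perp _ _ _)).
have wD j : normR (w j) <= (2 * C + 1) / kappa.
  rewrite normRZ mulrC normRV ler_pM ?normR_ge0 ?invr_ge0 ?normR_ge0//.
  by rewrite lef_pV2 ?posrE ?v_kappa// (lt_le_trans kappa_gt0 (v_kappa j)).
have D0' : 0 <= (2 * C + 1) / kappa by rewrite divr_ge0// ltW.
have [G [GD Gz Gu]] := orth_operator uE D0 (fun i j => block_orth zB zB) zD.
have [F [FD Fw _]] := orth_operator uE D0' (fun i j => block_orth wB wB) wD.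
have [E [ED _ Eu]] := summable_operator uE theta_ge0 vQ.
have zw j : z j + w j = hdot (w j) (u j) *: z j.
  by rewrite hdotZl zu mulrDr mulVf// mulr1 scalerDl scale1r.
have wz j : w j + z j = hdot (z j) (u j) *: w j.
  by rewrite zu scalerDl scale1r /w scalerA divff// scale1r addrC.
have Gb : bounded_op (@normR R H) (@normR R H) G by exists (2 * C + 1).
have Fb : bounded_op (@normR R H) (@normR R H) F by exists ((2 * C + 1) / kappa).
have [S0 S0E] : exists T : {linear H -> H}, forall a, T a = a - G a.
  by apply: linear_pack => r a b; rewrite linearP scalerBr opprD addrACA.
have [T0 T0E] : exists T : {linear H -> H}, forall a, T a = a - F a.
  by apply: linear_pack => r a b; rewrite linearP scalerBr opprD addrACA.
have T0K a : S0 (T0 a) = a.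
  rewrite S0E T0E; apply: (orth_operator_inv Gb _ zw Gz Fw) => i j.
  exact: (block_orth wB uB).
have S0K a : T0 (S0 a) = a.
  rewrite T0E S0E; apply: (orth_operator_inv Fb _ wz Fw Gz) => i j.
  exact: (block_orth zB uB).
have boundedB (K : H -> H) (r : R) : (forall a, normR (K a) <= r * normR a) ->
    forall a, normR (a - K a) <= (1 + r) * normR a.
  by move=> Kr a; rewrite (le_trans (ler_normRB _ _))// mulrDl mul1r lerD2l.
have S0GL : inGL S0.
  split; first by exists (1 + (2 * C + 1)) => a; rewrite S0E; exact: boundedB.
  exists T0; split=> //; exists (1 + (2 * C + 1) / kappa) => a.
  by rewrite T0E; exact: boundedB.
(* The target is $S_0(1-T_0E)=S_0-E$, and [theta_small] bounds $T_0E$ by one half. *)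
have [|T1 [T1GL T1E]] := @inGL_neumann _ _ (T0 \o E).
  move=> a; rewrite /= T0E (le_trans (boundedB _ _ FD _))//.
  apply: (@le_trans _ _ ((1 + (2 * C + 1) / kappa) * (2 * theta * normR a))).
    by rewrite ler_wpM2l// addr_ge0.
  by rewrite mulrA ler_wpM2r ?normR_ge0.
have [S [SGL SE]] := inGL_comp S0GL T1GL.
exists S; split=> // j; rewrite SE T1E linearB/= T0K S0E Gu Eu /z -/(t j).
by rewrite opprD addrCA subrr addr0 opprB addrAC subrr add0r.
Qed.

End Block_operator.

(** * Gliding humps *)

Section Humps.
Context {R : realType} {H : hilbertType R} (e : orthonormal_basis H).
Local Notation Q := (proj_perp e).

(* By polarization, <T a, b> is a combination of values of the quadratic form of
   T at the points a + c b with c = 1, -1, i, -i. *)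
Lemma numerical_range (T : {linear H -> H}) (a b : H) (k : R) :
  k * (normR a ^+ 2 + normR b ^+ 2) < normR (hdot (T a) b) ->
  exists c : R[i], k * normR (a + c *: b) ^+ 2 <
                   normR (hdot (T (a + c *: b)) (a + c *: b)).
Proof.
move=> ab; apply: contrapT => h.
have q c : normR (hdot (T (a + c *: b)) (a + c *: b)) <= k * normR (a + c *: b) ^+ 2.
  by rewrite leNgt; apply/negP => hc; apply: h; exists c.
pose i : R[i] := 'i%C.
have ii : i * i = -1 by rewrite /i; simpc.
have ci : Num.conj i = - i by rewrite /i; apply/eqP; rewrite eq_complex /= oppr0 !eqxx.
have ni : normR i = 1 by rewrite /normR normc_def/= expr0n/= add0r expr1n sqrtr1.
pose f c := hdot (T (a + c *: b)) (a + c *: b).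
pose g c := hdot (a + c *: b) (a + c *: b).
have fE c : f c = hdot (T a) a + Num.conj c * hdot (T a) b + c * hdot (T b) a +
    c * Num.conj c * hdot (T b) b.
  have TE : T (a + c *: b) = T a + c *: T b by rewrite linearD linearZ.
  by rewrite /f TE !(hdotDl, hdotDr, hdotZl, hdotZr); ring.
have gE c : g c = hdot a a + Num.conj c * hdot a b + c * hdot b a +
    c * Num.conj c * hdot b b.
  by rewrite /g !(hdotDl, hdotDr, hdotZl, hdotZr); ring.
have pol : 4%:R * hdot (T a) b = f 1 - f (-1) + i * f i - i * f (- i).
  rewrite !fE !rmorphN rmorph1 /= ci.
  by ring: ii.
(* The four bounds [q] add up to [k] times this sum, so polarization yields $4|\langle
   Ta,b\rangle|\le 4k(\|a\|^2+\|b\|^2)$, a contradiction. *)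
have par : g 1 + g (-1) + g i + g (- i) = 4%:R * (hdot a a + hdot b b).
  rewrite !gE !rmorphN rmorph1 /= ci.
  by ring: ii.
have {}par : normR (a + 1 *: b) ^+ 2 + normR (a + (-1) *: b) ^+ 2 +
    normR (a + i *: b) ^+ 2 + normR (a + (- i) *: b) ^+ 2 =
    4%:R * (normR a ^+ 2 + normR b ^+ 2).
  apply: complexI; rewrite mulr_natl rmorphMn !rmorphD/= !sqr_normRE.
  by rewrite -[RHS]mulr_natl; exact: par.
have : 4%:R * normR (hdot (T a) b) <= normR (f 1) + normR (f (-1)) +
    normR (f i) + normR (f (- i)).
  have -> : 4%:R * normR (hdot (T a) b) = normR (4%:R * hdot (T a) b).
    by rewrite normRM -[4%:R in RHS](rmorph_nat (real_complex R)) normRC ger0_norm.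
  rewrite pol (le_trans (ler_normRB _ _))// normRM ni mul1r lerD//.
  rewrite (le_trans (ler_normRD _ _))// normRM ni mul1r lerD//.
  exact: ler_normRB.
have := q 1; have := q (-1); have := q i; have := q (- i).
rewrite -/(f 1) -/(f (-1)) -/(f i) -/(f (- i)).
by move: (congr1 ( *%R k) par) ab; lra.
Qed.

Lemma normR_head_le n a : normR (a - Q n a) <= 2 * normR a.
Proof.
by rewrite (le_trans (ler_normRB _ _))// mulr_natl mulr2n lerD2l normR_proj_perp.
Qed.

Lemma hdot_head n a : hdot a (a - Q n a) = (normR (a - Q n a) ^+ 2)%:C%C.
Proof.
rewrite sqr_normRE; apply/eqP; rewrite -subr_eq0 -hdotBl opprB addrC subrK.
by rewrite hdot_proj_perpC (linearB (Q n))/= proj_perp_maxn maxnn subrr hdot0r.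
Qed.

Lemma proj_perp_supp p n a : Q p a = a -> Q p (a - Q n a) = a - Q n a.
Proof. by move=> aE; rewrite linearB/= aE proj_perp_maxn maxnC -proj_perp_maxn aE. Qed.

Lemma head_supp n r a : (n <= r)%N -> Q r (a - Q n a) = 0.
Proof. by move=> /maxn_idPl nr; rewrite linearB/= proj_perp_maxn nr subrr. Qed.

End Humps.

(** * Small tails from IM-continuity *)

Section Converse.
Context {R : realType} {H : hilbertType R} (e : orthonormal_basis H).
Context {X : compactHausdorffType}.
Local Notation l2A := (l2 R X).
Local Notation Q := (proj_perp e).
Variable K : {linear l2A -> l2A}.
Hypothesis Kb : bounded_op (@l2_norm R X) (@l2_norm R X) K.

Lemma basis_tails p (d : R) : 0 < d -> exists N, forall n x k, (N <= n)%N ->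
  (k < p)%N -> normR (Q n (DD e K x (e k))) <= d.
Proof.
move=> d0.
have /choice[f fP] := fun k : 'I_p => l2_tail e (K (l2_cst e X (e k))) d0.
exists (\max_k f k) => n x k fn kp.
by apply: (fP (Ordinal kp)); rewrite (leq_trans _ fn)// leq_bigmax.
Qed.

(** A vector [a] with $\|Q_nK_ya\|$ large is cut to a finitely supported [w], and [b] is a multiple
    of a truncation of [T w], so $\langle Tw,b\rangle$ is large; [numerical_range] moves this to the
    quadratic form of [T] at some $w+cb$, which is then normalized. *)
Lemma exists_hump (C eps : R) : 0 < C -> 0 < eps ->
  (forall x a, normR (DD e K x a) <= C * normR a) ->
  (forall n, exists x a, normR a <= 1 /\ eps < normR (Q n (DD e K x a))) ->
  forall p (eta : R), 0 < eta -> exists n q y u, [/\ (p <= n)%N, (p < q)%N,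
    Q p u = u, Q q u = 0 & [/\ normR u = 1,
    (eps / 16%:R) ^+ 2 / (2 * C) <= normR (hdot (Q n (DD e K y u)) u) &
    normR (Q q (Q n (DD e K y u))) <= eta]].
Proof.
move=> C0 e0 KC Kn p eta eta0.
have d0 : 0 < eps / 4%:R / p.+1%:R by rewrite !divr_gt0.
have [N NP] := basis_tails p d0.
(* Beyond the tails of $K_ye_k$ for [k < p]: dropping the first [p] coordinates of [a] then changes
   [T a] by at most [eps / 4]. *)
pose n := maxn N p; have pn : (p <= n)%N by rewrite leq_maxr.
have [y [a [a1 ya]]] := Kn n.
have [T TE] : exists T : {linear H -> H}, forall a, T a = Q n (DD e K y a).
  by exists (Q n \o DD e K y).
rewrite -TE in ya.
have TC b : normR (T b) <= C * normR b.
  by rewrite TE (le_trans (normR_proj_perp _ _ _)).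
have TP b : Q p (T b) = T b by rewrite TE proj_perp_maxn (maxn_idPr pn).
have hP : normR (T (a - Q p a)) <= eps / 4%:R.
  rewrite opprB addrC subrK linear_sum (le_trans (normR_sum _ _ _))//.
  apply: (@le_trans _ _ (\sum_(k < p) eps / 4%:R / p.+1%:R)).
    apply: ler_sum => k _; rewrite linearZ/= normRZ -[leRHS]mul1r.
    rewrite ler_pM ?normR_ge0//; last by rewrite TE NP// leq_maxl.
    by rewrite (le_trans (normR_hdot_le _ _))// normR_onb mulr1.
  rewrite sumr_const card_ord -[leLHS]mulr_natr -mulrA ler_piMr ?divr_ge0 ?(ltW e0)//.
  by rewrite ler_pdivrMl// mulr1 ler_nat.
have eC : 0 < eps / 4%:R / C by rewrite !divr_gt0.
have [m mP] := proj_perp_cvg0 e a eC.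
pose w := Q p a - Q m (Q p a).
have hm : normR (T (Q m (Q p a))) <= eps / 4%:R.
  rewrite (le_trans (TC _))// mulrC -ler_pdivlMr// proj_perp_maxn.
  by rewrite ltW// mP// leq_maxl.
have Tw : eps / 2 < normR (T w).
  have h1 := normR_le_add (T a) (T (Q p a)).
  have h2 := normR_le_add (T (Q p a)) (T w).
  move: h1 h2 hP hm; rewrite -!linearB/=.
  rewrite (_ : Q p a - w = Q m (Q p a)); last exact: subKr.
  by move: ya; lra.
have w2 : normR w <= 2.
  rewrite (le_trans (normR_head_le _ _ _))// ler_piMr//.
  by rewrite (le_trans (normR_proj_perp _ _ _)).
have e4 : 0 < eps / 4%:R by rewrite divr_gt0.
have [r rP] := proj_perp_cvg0 e (T w) e4.
pose b0 := T w - Q r (T w).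
have b0_gt : eps / 4%:R < normR b0.
  have := normR_le_add (T w) b0.
  rewrite (_ : T w - b0 = Q r (T w)); last exact: subKr.
  by have := rP r (leqnn r); move: Tw; lra.
have b0_le : normR b0 <= 4%:R * C.
  rewrite (le_trans (normR_head_le _ _ _))// (_ : 4%:R * C = 2 * (C * 2)); last by ring.
  by rewrite ler_wpM2l// (le_trans (TC _))// ler_wpM2l// ltW.
(* Scales [b0], of norm at most [4 * C], to norm at most 2, the bound available for [w]. *)
pose s : R := (2 * C)^-1.
have s0 : 0 < s by rewrite invr_gt0 mulr_gt0.
have sC : s * C = 2^-1 by rewrite /s invfM mulrAC -mulrA divff ?mulr1// gt_eqF.
have ns : normR (s%:C%C : R[i]) = s by rewrite normRC ger0_norm// ltW.
pose b := s%:C%C *: b0.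
have b2 : normR b <= 2.
  by rewrite normRZ ns (le_trans (ler_wpM2l (ltW s0) b0_le))// mulrCA sC; lra.
have wb : normR (hdot (T w) b) = s * normR b0 ^+ 2.
  rewrite hdotZr hdot_head normRM normRC (ger0_norm (sqr_ge0 _)).
  by congr (_ * _); rewrite -[RHS]ns /normR norm_conjC.
(* The 16 is large enough: [k] times $2^2+2^2$ is $s\varepsilon^2/32$, below the lower bound
   $s(\varepsilon/4)^2$ for $|\langle Tw,b\rangle|$. *)
pose k := (eps / 16%:R) ^+ 2 / (2 * C); rewrite -/k.
have k0 : 0 <= k by rewrite mulr_ge0 ?sqr_ge0// ltW.
have [c cP] : exists c : R[i], k * normR (w + c *: b) ^+ 2 <
    normR (hdot (T (w + c *: b)) (w + c *: b)).
  apply: numerical_range; rewrite wb.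
  apply: (@le_lt_trans _ _ (k * (2 ^+ 2 + 2 ^+ 2))).
    by rewrite ler_wpM2l ?k0// lerD// lerXn2r ?nnegrE ?normR_ge0.
  apply: (@lt_le_trans _ _ (s * (eps / 4%:R) ^+ 2)).
    rewrite /k -/s mulrC -subr_gt0.
    rewrite (_ : _ - _ = s * (eps / 4%:R) ^+ 2 / 2); last by field.
    by rewrite divr_gt0// mulr_gt0// exprn_gt0.
  by rewrite ler_wpM2l ?(ltW s0)// lerXn2r ?nnegrE ?normR_ge0 ?(ltW e4)// ltW.
set z := w + c *: b in cP.
have wP : Q p w = w by apply: proj_perp_supp; rewrite proj_perp_maxn maxnn.
have bP : Q p b0 = b0 by exact: proj_perp_supp.
have zP : Q p z = z by rewrite /z /b scalerA linearD linearZ/= wP bP.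
pose mr := maxn m r.
have zQ q : (mr <= q)%N -> Q q z = 0.
  rewrite geq_max => /andP[mq rq].
  have wQ : Q q w = 0 by exact: head_supp.
  have bQ : Q q b0 = 0 by exact: head_supp.
  by rewrite /z /b scalerA linearD linearZ/= wQ bQ scaler0 addr0.
have z0 : 0 < normR z.
  rewrite lt_neqAle normR_ge0 andbT eq_sym; apply/negP => /eqP/normR0_eq0 zz.
  by move: cP; rewrite zz hdot0r !normR0 expr0n mulr0 ltxx.
pose rho : R := (normR z)^-1; have rho0 : 0 < rho by rewrite invr_gt0.
have nrho : normR (rho%:C%C : R[i]) = rho by rewrite normRC ger0_norm// ltW.
pose u := rho%:C%C *: z.
have [N' N'P] := proj_perp_cvg0 e (T u) eta0.
(* [mr] clears the support of [u], [p.+1] gives strict growth, and [N'] makes the tail of [T u]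
   small. *)
exists n, (maxn (maxn mr p.+1) N'), y, u.
split=> //.
- by rewrite leq_max leq_max leqnn orbT.
- by rewrite linearZ/= zP.
- by rewrite linearZ/= zQ ?scaler0// -maxnA leq_maxl.
split; first by rewrite normRZ nrho mulVf// gt_eqF.
  have TuE : T u = rho%:C%C *: T z by rewrite /u linearZ.
  rewrite -TE TuE hdotZl hdotZr !normRM nrho.
  rewrite [normR (Num.conj _)](_ : _ = rho); last first.
    by rewrite -[RHS]nrho /normR norm_conjC.
  rewrite mulrA -expr2 exprVn mulrC ler_pdivlMr ?exprn_gt0//.
  exact: ltW.
by rewrite -TE ltW// N'P// leq_maxr.
Qed.

Lemma IM_continuous_uniform_tails (Kc : forall x, compact_op (DD e K x)) :
  continuous (fun x : X => CompactOp (Kc x) : IMspace e) -> uniform_tails e K.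
Proof.
move=> Kcont eps e0; apply: contrapT => nt.
have [C C0 KC] := DD_bounded e Kb.
have Kn n : exists x a, normR a <= 1 /\ eps < normR (Q n (DD e K x a)).
  apply: contrapT => h; apply: nt; exists n => x.
  apply: (@linear_unit_ball _ _ (Q n \o DD e K x)) => a a1; rewrite leNgt.
  by apply/negP => ea; apply: h; exists x, a.
pose kappa := (eps / 16%:R) ^+ 2 / (2 * C).
have k0 : 0 < kappa by rewrite divr_gt0 ?mulr_gt0 ?exprn_gt0 ?divr_gt0.
pose M := 1 + (2 * C + 1) / kappa.
have M0 : 0 < M by rewrite ltr_pwDl// divr_ge0 ?(ltW k0)// addr_ge0// mulr_ge0// ltW.
(* Makes [theta_small] an equality: [M * (2 * theta)] is one half. *)
pose theta := (4%:R * M)^-1.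
have t0 : 0 < theta by rewrite invr_gt0 mulr_gt0.
have /choice[f fP] : forall jp : nat * nat, exists s : nat * nat * X * H,
    [/\ (jp.2 <= s.1.1.1)%N, (jp.2 < s.1.1.2)%N, Q jp.2 s.2 = s.2,
      Q s.1.1.2 s.2 = 0 & [/\ normR s.2 = 1,
      kappa <= normR (hdot (Q s.1.1.1 (DD e K s.1.2 s.2)) s.2) &
      normR (Q s.1.1.2 (Q s.1.1.1 (DD e K s.1.2 s.2))) <= theta * 2%:R ^- jp.1]].
  move=> [j p]; have eta0 : 0 < theta * 2%:R ^- j.
    by rewrite mulr_gt0// invr_gt0 exprn_gt0.
  have [n [q [y [u h]]]] := exists_hump C0 e0 KC Kn p eta0.
  by exists (n, q, y, u).
pose p := fix p j := if j is j'.+1 then (f (j', p j')).1.1.2 else 0%N.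
pose s j := f (j, p j); pose n j := (s j).1.1.1; pose y j := (s j).1.2.
pose u j := (s j).2; pose v j := Q (n j) (DD e K (y j) (u j)).
have pS j : (s j).1.1.2 = p j.+1 by [].
have sP j : [/\ (p j <= n j)%N, (p j < p j.+1)%N, Q (p j) (u j) = u j,
    Q (p j.+1) (u j) = 0 & [/\ normR (u j) = 1, kappa <= normR (hdot (v j) (u j)) &
    normR (Q (p j.+1) (v j)) <= theta * 2%:R ^- j]] by exact: (fP (j, p j)).
have jp j : (j <= p j)%N.
  elim: j => // j IH; have [_ h _ _ _] := sP j; exact: leq_ltn_trans IH h.
have [|||||||||||S [SGL SE]] := @block_GL _ _ e p u v C kappa theta.
- by move=> j; have [_ /ltnW] := sP j.
- by move=> j; have [] := sP j.
- by move=> j; have [] := sP j.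
- by move=> j; have [_ _ _ _ []] := sP j.
- move=> j; have [pn _ _ _ _] := sP j.
  by rewrite /v proj_perp_maxn (maxn_idPr pn).
- move=> j; have [_ _ _ _ [uj _ _]] := sP j.
  by rewrite (le_trans (normR_proj_perp _ _ _))// (le_trans (KC _ _))// uj mulr1.
- exact: k0.
- by move=> j; have [_ _ _ _ []] := sP j.
- exact: ltW.
- by move=> j; have [_ _ _ _ []] := sP j.
- rewrite -/M /theta invfM (_ : _ * _ = M / M * 2^-1); last by field; rewrite gt_eqF.
  by rewrite divff ?mul1r// gt_eqF.
have [z [_ zcl]] := @compactX X (y @ \oo) _ (@filterT _ _ _).
have k4 : 0 < kappa / 4%:R by rewrite divr_gt0.
have k2 : 0 < kappa / 2 by rewrite divr_gt0.
pose W : set (IMspace e) := IM_GL e (kappa / 2) S (CompactOp (Kc z)).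
have Wz : W (CompactOp (Kc z)).
  move=> m _; have [T [TGL TE]] := @inGL1 R H; exists T => //.
  apply: le_lt_trans k2; apply: opnorm_le => [|a _]; first by exists 0; rewrite normR0.
  by rewrite TE subrr normR0.
have Wo : open W.
  by apply: IM_subbase_open; right; exists (kappa / 2), S, (CompactOp (Kc z)).
have nW : nbhs z [set x | W (CompactOp (Kc x))].
  by apply: Kcont; exact: open_nbhs_nbhs.
have [N NP] := compact_op_tails e (Kc z) k4.
(* As [z] is a cluster point, some [y j] with [j] beyond [N] falls into the neighbourhood; then
   $n_j\ge p_j\ge j\ge N$. *)
have yN : (y @ \oo) [set x | exists2 j, (N <= j)%N & x = y j].
  by exists N => // j Nj; exists j.
have [_ [[j Nj ->] Wy]] := zcl _ _ yN nW.
have [_ _ _ _ [uj vj _]] := sP j.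
have [T TGL] := Wy (n j) I.
have Nn : (N <= n j)%N.
  by have [pn _ _ _ _] := sP j; rewrite (leq_trans Nj)// (leq_trans (jp j)).
have Kyb x : bounded_op (@normR R H) (@normR R H) (DD e K x).
  by exists C; exact: KC.
have uj1 : normR (u j) <= 1 by rewrite uj.
have := le_opnorm (@normR_ge0 R H)
  (IM_diff_bounded e (n j) SGL.1 TGL.1 (Kyb (y j)) (Kyb z)) uj1.
(* The invertible factor acts on $Su_j+v_j=0$, so the difference at $u_j$ reduces to
   $v_j-Q_{n_j}K_zu_j$, of norm at least $\kappa-\kappa/4$, while membership in [W] forces less than
   $\kappa/2$. *)
rewrite /= -/(v j) SE addNr linear0 sub0r normRN => h1 /(le_lt_trans h1) h2.
have := normR_le_add (- v j) (- Q (n j) (DD e K z (u j))).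
rewrite opprK !normRN => h3.
have h4 := NP _ _ Nn uj1.
have h5 : kappa <= normR (v j).
  by rewrite (le_trans vj)// (le_trans (normR_hdot_le _ _))// uj mulr1.
by move: k0 h2 h3 h4 h5; lra.
Qed.

End Converse.

(** [Kc] supplies the compactness proofs that turn $\mathcal D(K)$ into a map to $\mathcal K(H)$;
    only then does IM-continuity make sense. *)
Theorem theorem8 (R : realType) (H : hilbertType R) (e : orthonormal_basis H)
    (X : compactHausdorffType) (K : {linear l2 R X -> l2 R X})
    (Kbounded : bounded_op (@l2_norm R X) (@l2_norm R X) K) :
  compact_Aop K <->
  exists Kc : forall x : X, compact_op (DD e K x),
    continuous (fun x : X => CompactOp (Kc x) : IMspace e).
Proof.
split=> [/(compact_uniform_tails e) Kt|[Kc Kcont]].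
  exists (DD_compact_op Kbounded Kt); exact: DD_IM_continuous.
exact: uniform_tails_compact Kbounded (IM_continuous_uniform_tails Kbounded Kcont).
Qed.
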